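(* Let $N$ be a discrete group with trivial amenable radical and let $H \neq \{e\}$ be a discrete torsion-free abelian group. If $G := N \times H$, then the canonical embedding $C_r^*(G) \subseteq C(\partial_F G) \rtimes_r G$ is not an SP-inclusion. In particular, for a countable, discrete, non-amenable group $G$ the embedding $C_r^*(G) \subseteq C(\partial_F G) \rtimes_r G$ need not be an SP-inclusion (and therefore need not be an inclusion of real rank zero); that is, there exists a countable, discrete, non-amenable group $G$ for which this embedding is not an SP-inclusion, and hence not an inclusion of real rank zero.
   Context: An inclusion of C*-algebras $A \subseteq B$ is called an SP-inclusion if for every nonzero element $a \in A_+$ the hereditary C*-subalgebra $\overline{aBa}$ of $B$ contains a nonzero projection; it is called an inclusion of real rank zero if for every nonzero $a \in A_+$ the C*-algebra $\overline{aBa}$ contains an approximate identity consisting of projections. The amenable radical of a discrete group is its largest normal amenable subgroup. A group is torsion-free if its only element of finite order is the identity. For a discrete group $G$, the Furstenberg boundary $\partial_F G$ is the universal compact (Hausdorff) $G$-space on which the action of $G$ is minimal (every orbit is dense) and strongly proximal (for any two probability measures $\mu,\nu$ on the space there is a net $(g_i)$ in $G$ with $\lim g_i\mu = \lim g_i \nu$ in the weak* topology); universal means that every compact $G$-space with minimal and strongly proximal action is a continuous $G$-equivariant image of $\partial_F G$. $C_r^*(G)$ is the reduced group C*-algebra, $C(\partial_F G)\rtimes_r G$ is the reduced crossed product by the induced action, and the canonical embedding sends the generating unitaries of $C_r^*(G)$ to the unitaries implementing the action in the crossed product. *)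

(* Defs.v *)
From HB Require Import structures.
From mathcomp Require Import all_boot all_order all_algebra.
From mathcomp Require Import complex.
From mathcomp Require Import all_classical all_reals all_analysis.
From mathcomp Require summability.
From mathcomp Require Import ring.

Set Implicit Arguments.
Unset Strict Implicit.
Unset Printing Implicit Defensive.
Import Order.TTheory GRing.Theory Num.Theory.
Import numFieldNormedType.Exports.
Local Open Scope classical_set_scope.
Local Open Scope ring_scope.

Section Groups.
Variables (R : realType) (G : groupType).
Implicit Types K : set G.

Definition is_subgroup K :=
  [/\ K 1%g, forall x y, K x -> K y -> K (x * y)%g & forall x, K x -> K x^-1%g].

Definition is_normal_subgroup K :=
  is_subgroup K /\ forall g x, K x -> K (x ^ g)%g.

(* [m] is a left-invariant mean on the subgroup [K], seen as a finitely additive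
   probability measure on all subsets of [K]. *)
Definition amenable K :=
  exists m : set G -> R,
    [/\ forall A, A `<=` K -> 0 <= m A,
        m K = 1,
        forall A B, A `<=` K -> B `<=` K -> A `&` B = set0 ->
          m (A `|` B) = m A + m B
      & forall k A, K k -> A `<=` K -> m [set (k * x)%g | x in A] = m A].

Definition is_amenable_radical K :=
  [/\ is_normal_subgroup K, amenable K
    & forall L, is_normal_subgroup L -> amenable L -> L `<=` K].

Definition torsion_free :=
  forall (x : G) (n : nat), (0 < n)%N -> (x ^+ n)%g = 1%g -> x = 1%g.

End Groups.

Definition borel (X : ptopologicalType) := g_sigma_algebraType (@open X).

Section Boundary.
Variables (R : realType) (G : groupType).

(* [ptopologicalType] carries a base point, so these spaces are nonempty. *)
Record compact_G_space (X : ptopologicalType) (act : G -> X -> X) : Prop := {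
  cgs_compact : compact [set: X];
  cgs_hausdorff : hausdorff_space X;
  cgs_act1 : forall x, act 1%g x = x;
  cgs_actM : forall g h x, act (g * h)%g x = act g (act h x);
  cgs_continuous : forall g, continuous (act g)
}.

Definition minimal_action (X : ptopologicalType) (act : G -> X -> X) :=
  forall x, dense (range (act^~ x)).

(* On a compact Hausdorff space, probability measures are understood to be
   regular Borel measures; for a finite measure inner regularity suffices. *)
Definition regular (X : ptopologicalType) (mu : set (borel X) -> \bar R) :=
  forall A : set (borel X), measurable A ->
    mu A = ereal_sup [set mu K | K in [set K : set X | compact K /\ K `<=` A]].

Definition weak_star_cvg (X : ptopologicalType) (I : Type) (F : set_system I)
    (mu_ : I -> set (borel X) -> \bar R) (mu : set (borel X) -> \bar R) :=
  forall f : X -> R, continuous f ->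
    fine (\int[mu_ i]_(x in [set: borel X]) (f x)%:E) @[i --> F] -->
    fine (\int[mu]_(x in [set: borel X]) (f x)%:E).

(* The net (g_i) is given by its filter of tails, a proper filter on [G]. *)
Definition strongly_proximal (X : ptopologicalType) (act : G -> X -> X) :=
  forall mu nu : probability (borel X) R, regular mu -> regular nu ->
  exists F : set_system G, ProperFilter F /\
  exists rho : probability (borel X) R, [/\ regular rho,
    weak_star_cvg F
      (fun g => pushforward mu (act g : borel X -> borel X)) rho
  & weak_star_cvg F
      (fun g => pushforward nu (act g : borel X -> borel X)) rho].

Definition is_boundary (X : ptopologicalType) (act : G -> X -> X) :=
  [/\ compact_G_space act, minimal_action act & strongly_proximal act].

(* [X] is the Furstenberg boundary of [G]: this universal property determines it
   up to equivariant homeomorphism. *)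
Definition is_furstenberg_boundary (X : ptopologicalType) (act : G -> X -> X) :=
  is_boundary act /\
  forall (Y : ptopologicalType) (actY : G -> Y -> Y), is_boundary actY ->
    exists phi : X -> Y, [/\ continuous phi, set_surj setT setT phi
      & forall g x, phi (act g x) = actY g (phi x)].

End Boundary.

Section Ell2.
Variables (R : realType) (I : choiceType).

Definition sqnorm (x : I -> R[i]) : \bar R :=
  \esum_(i in [set: I]) (Normc.normc (x i) ^+ 2)%:E.

Definition sqsummable : {pred I -> R[i]} := [pred x | (sqnorm x < +oo)%E].

Let normcE (z : R[i]) : Normc.normc z ^+ 2 = complex.Re z ^+ 2 + complex.Im z ^+ 2.
Proof. by case: z => a b /=; rewrite sqr_sqrtr// addr_ge0// sqr_ge0. Qed.

Let normc_le (a u v : R[i]) : Normc.normc (a * u + v) ^+ 2 <=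
  (2 * Normc.normc a ^+ 2) * Normc.normc u ^+ 2 + 2 * Normc.normc v ^+ 2.
Proof.
rewrite -mulrA -exprMn -Normc.normcM; move: (a * u) => {a}u.
rewrite !normcE; case: u v => [u1 u2] [v1 v2] /=.
rewrite -subr_ge0.
have -> : 2 * (u1 ^+ 2 + u2 ^+ 2) + 2 * (v1 ^+ 2 + v2 ^+ 2) -
  ((u1 + v1) ^+ 2 + (u2 + v2) ^+ 2) = (u1 - v1) ^+ 2 + (u2 - v2) ^+ 2.
  by ring.
by rewrite addr_ge0// sqr_ge0.
Qed.

Let esum_scale (c : R) (f : I -> R) : 0 <= c -> (forall i, 0 <= f i) ->
  (\esum_(i in [set: I]) (f i)%:E < +oo)%E ->
  (\esum_(i in [set: I]) (c * f i)%:E < +oo)%E.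
Proof.
move=> c0 f0 foo; apply: (@le_lt_trans _ _ (c%:E * \esum_(i in [set: I]) (f i)%:E)%E).
  rewrite [leLHS]/esum ge_ereal_sup// => _ [A [finA _] <-].
  under eq_fsbigr do rewrite EFinM.
  rewrite -ge0_mule_fsumr; last by move=> i; rewrite lee_fin.
  by rewrite lee_wpmul2l ?lee_fin// esum_ge//; exists A.
by rewrite lte_mul_pinfty// ?lee_fin//; apply/fin_numPlt; rewrite foo andbT;
  apply: lt_le_trans (esum_ge0 _) => // i _; rewrite lee_fin.
Qed.

Lemma sqsummable_submod_closed : submod_closed sqsummable.
Proof.
split.
  rewrite inE/= /sqnorm esum1// => i _.
  by rewrite -[(0 : I -> R[i]) i]/(0 : R[i]) Normc.normc0 expr0n.
move=> a x y; rewrite !inE /= /sqnorm => hx hy.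
apply: le_lt_trans (_ : (\esum_(i in [set: I])
  (((2 * Normc.normc a ^+ 2) * Normc.normc (x i) ^+ 2)%:E
    + (2 * Normc.normc (y i) ^+ 2)%:E) < +oo)%E).
  by apply: le_esum => i _; rewrite -EFinD lee_fin normc_le.
rewrite esumD; first last.
- by move=> i _; rewrite lee_fin mulr_ge0// sqr_ge0.
- by move=> i _; rewrite lee_fin mulr_ge0 ?sqr_ge0// mulr_ge0 ?sqr_ge0.
have c0 : 0 <= 2 * Normc.normc a ^+ 2 by rewrite mulr_ge0// sqr_ge0.
by rewrite lte_add_pinfty// esum_scale// => i; exact: sqr_ge0.
Qed.

HB.instance Definition _ := GRing.isSubmodClosed.Build R[i] (I -> R[i])
  sqsummable sqsummable_submod_closed.

Record ell2 := Ell2 {ell2_fun :> I -> R[i]; _ : sqsummable ell2_fun}.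

HB.instance Definition _ := [isSub for ell2_fun].
HB.instance Definition _ := [Choice of ell2 by <:].
HB.instance Definition _ := [SubChoice_isSubLmodule of ell2 by <:].

Definition l2norm (x : ell2) : R := Num.sqrt (fine (sqnorm x)).

(* [summability.sum] is the unconditional sum, that is the limit of the partial
   sums along the directed set of finite subsets of [I]. *)
Definition l2dot (x y : ell2) : R[i] :=
  summability.sum (fun i => x i * (y i)^*%C : R[i]^o).

End Ell2.

(* Every Hilbert space is isometric to some l^2(I), and a C*-algebra is given as
   a set of bounded operators on l^2(I): products are compositions, and sums and
   differences are taken pointwise. *)

Section Operators.
Variables (R : realType) (I : choiceType).
Local Notation H := (ell2 R I).
Implicit Types (T S a b c e p : H -> H) (A B D M : set (H -> H)).

Definition opnorm T : \bar R :=
  ereal_sup [set (l2norm (T x))%:E | x in [set x | l2norm x <= 1]].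

Definition bounded_operator T := linear T /\ (opnorm T < +oo)%E.

Definition is_adjoint T S := forall x y, l2dot (T x) y = l2dot x (S y).

Definition norm_closure M : set (H -> H) :=
  [set T | bounded_operator T /\
    forall eps : R, 0 < eps -> exists2 S, M S & (opnorm (T - S)%R < eps%:E)%E].

Definition positive_part A : set (H -> H) :=
  [set a | exists b bstar, [/\ A b, A bstar, is_adjoint b bstar
                             & a = bstar \o b]].

Definition hereditary_subalgebra B a : set (H -> H) :=
  norm_closure [set a \o b \o a | b in B].

Definition is_projection p :=
  [/\ bounded_operator p, p \o p = p & is_adjoint p p].

Definition SP_inclusion A B :=
  forall a, positive_part A a -> a != 0 ->
  exists p, [/\ hereditary_subalgebra B a p, is_projection p & p != 0].

(* The approximate identity, a net of projections in [D], is given by its filter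
   of tails. *)
Definition has_approximate_identity_of_projections D :=
  exists F : set_system (H -> H), [/\ ProperFilter F,
    F [set e | D e /\ is_projection e]
  & forall c, D c ->
      (fun e : H -> H => opnorm (e \o c - c)) @ F --> 0%E /\
      (fun e : H -> H => opnorm (c \o e - c)) @ F --> 0%E].

Definition real_rank_zero_inclusion A B :=
  forall a, positive_part A a -> a != 0 ->
  has_approximate_identity_of_projections (hereditary_subalgebra B a).

End Operators.

Section CrossedProduct.
Variables (R : realType) (G : groupType).

(* The image of the group algebra C[G] under the left regular representation
   (lambda_s xi) g = xi (s^-1 g); a finite sequence of pairs (s, z) stands for
   the sum of the z lambda_s. *)
Definition group_algebra_operators : set (ell2 R G -> ell2 R G) :=
  [set T : ell2 R G -> ell2 R G | exists s : seq (G * R[i]), forall xi g,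
    T xi g = \sum_(q <- s) q.2 * xi (q.1^-1 * g)%g].

Definition reduced_group_algebra := norm_closure group_algebra_operators.

Section WithSpace.
Variables (X : ptopologicalType) (act : G -> X -> X).
Local Notation GX := (G * X)%type.

(* The image of C_c(G, C(X)) under the regular representation on
   l^2(G, l^2(X)) = l^2(G * X) induced by the faithful representation of C(X) on
   l^2(X) by multiplication operators:
     (pi(f) xi)(g, x) = (g^-1 . f)(x) xi(g, x) = f(g x) xi(g, x)
     (u_s xi)(g, x) = xi(s^-1 g, x).
   A finite sequence of pairs (s, f) stands for the sum of the pi(f) u_s. *)
Definition algebraic_crossed_product_operators :
    set (ell2 R GX -> ell2 R GX) :=
  [set T : ell2 R GX -> ell2 R GX | exists2 s : seq (G * (X -> R[i]^o)),
     (forall q, q \in s -> continuous q.2)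
   & forall xi g x,
     T xi (g, x) = \sum_(q <- s) q.2 (act g x) * xi ((q.1^-1 * g)%g, x)].

Definition reduced_crossed_product :=
  norm_closure algebraic_crossed_product_operators.

(* [S = T (x) 1] on l^2(G * X) = l^2(G) (x) l^2(X). *)
Definition is_amplification (T : ell2 R G -> ell2 R G)
    (S : ell2 R GX -> ell2 R GX) :=
  forall (xi : ell2 R GX) (x : X) (eta : ell2 R G),
    (forall g, eta g = xi (g, x)) -> forall g, S xi (g, x) = T eta g.

(* The canonical embedding of the reduced group C*-algebra is T |-> T (x) 1: it
   maps lambda_s to the unitary u_s. This is its image. *)
Definition embedded_reduced_group_algebra : set (ell2 R GX -> ell2 R GX) :=
  [set S | bounded_operator S /\
     exists2 T, reduced_group_algebra T & is_amplification T S].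

End WithSpace.
End CrossedProduct.

Arguments embedded_reduced_group_algebra R G X : clear implicits.
Arguments reduced_crossed_product R {G X} act.

(* Main.v *)
Require Import Defs.
From HB Require Import structures.
From mathcomp Require Import all_boot all_order all_algebra.
From mathcomp Require Import complex.
From mathcomp Require Import all_classical all_reals all_analysis.
From mathcomp Require summability.
From mathcomp Require Import finmap measurable_realfun ring lra.
Set Implicit Arguments.
Unset Strict Implicit.
Unset Printing Implicit Defensive.
Import Order.TTheory GRing.Theory Num.Theory.
Import numFieldNormedType.Exports.
Local Open Scope classical_set_scope.
Local Open Scope ring_scope.

(** Let [G] be a group with a central element [h] and a homomorphism [phi] to the
   reals with [phi h = 1], and let [G] act on a boundary [X].  The obstruction is
   the element [a = (1 - u)^* (1 - u)], where [u] is the unitary of [h]: no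
   nonzero projection lies in the hereditary subalgebra that [a] generates in the
   reduced crossed product.

   First, [h] acts trivially on [X] ([central_acts_trivially]), so [u] is central
   in the crossed product.  The intuition is then that a projection [p] of the
   hereditary subalgebra is a continuous field of projections over the spectrum
   of [u], zero at [1]; since [phi] provides rotations of that spectrum, the field
   is zero everywhere.  To avoid disintegrating over the spectrum, the rotations
   are used on the Hilbert space: the unitaries [flow s], multiplication by
   [e^(i s phi)], carry [u] to a scalar multiple of [u], and conjugation by them
   moves every element of the crossed product norm-continuously
   ([algebraic_tame], [reduced_tame]).  Because [p] is close to some [a c a], the
   operator [1 - u] is bounded below on the range of [p].  Transporting the range
   by [flow s] and projecting it back on the range of [p], which almost does not
   change a vector when [s] is small, shows that [1 - e^(i t) u] is bounded below
   there too, for [t] small; finitely many steps go round the circle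
   ([bounded_below_segment]).  But a unitary has some approximate eigenvalue, as
   soon as it acts on a nonzero vector ([approximate_eigenvector]); hence [p] is
   zero ([bounded_below_trivial]).

   For the product of [N] with a torsion-free abelian [H] any nontrivial [h] in
   [H] will do: Zorn's lemma and the divisibility of the reals extend the
   homomorphism [h^n -> n] to [H] ([exists_real_character]).  A countable
   non-amenable example is [GL_2(Q)], with [h] the scalar matrix [2] and [phi] a
   multiple of the logarithm of the absolute value of the determinant; it is not
   amenable because it plays ping-pong on the plane ([gl2q_not_amenable]).

   All estimates use the squared norm [sqn]: the parallelogram law replaces the
   triangle inequality, at the cost of constants that do not matter. *)

(** * The squared norm of l^2(I) *)

Section SquaredModulus.
Variable R : realType.
Implicit Types z w : R[i].

Definition absq z : R := Normc.normc z ^+ 2.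

Lemma absqE z : absq z = complex.Re z ^+ 2 + complex.Im z ^+ 2.
Proof. by rewrite /absq; case: z => a b /=; rewrite sqr_sqrtr// addr_ge0// sqr_ge0. Qed.

Lemma absq_ge0 z : 0 <= absq z. Proof. exact: sqr_ge0. Qed.

Lemma absqM z w : absq (z * w) = absq z * absq w.
Proof. by rewrite /absq Normc.normcM exprMn. Qed.

Lemma absq0 : absq 0 = 0. Proof. by rewrite absqE/=; ring. Qed.

Lemma absq_eq0 z : absq z = 0 -> z = 0.
Proof. by move=> /eqP; rewrite sqrf_eq0 => /eqP/Normc.eq0_normc. Qed.

Lemma absq_parallelogram z w :
  absq (z + w) + absq (z - w) = 2 * absq z + 2 * absq w.
Proof. by rewrite !absqE; case: z w => [a b] [c d] /=; ring. Qed.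

End SquaredModulus.

Section SquaredNorm.
Variables (R : realType) (I : choiceType).
Local Notation H := (ell2 R I).
Implicit Types (x y : H) (c : R[i]) (i : I).

Lemma ell2P (x y : H) : (forall i, x i = y i) -> x = y.
Proof. by move=> xy; apply/val_inj/funext. Qed.

Lemma ell2B (x y : H) i : (x - y) i = x i - y i. Proof. by []. Qed.
Lemma ell2Z c (x : H) i : (c *: x) i = c * x i. Proof. by []. Qed.
Lemma ell2L c (x y : H) i : (c *: x + y) i = c * x i + y i. Proof. by []. Qed.

Definition sqn x : R := fine (sqnorm x).

Lemma sqnorm_ge0 (f : I -> R[i]) : (0 <= sqnorm f)%E.
Proof. by apply: esum_ge0 => i _; rewrite lee_fin sqr_ge0. Qed.

Lemma sqnE x : (sqn x)%:E = sqnorm x.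
Proof.
rewrite fineK//; apply/fin_numPlt; case: x => f /= fI.
by rewrite (lt_le_trans _ (sqnorm_ge0 f)).
Qed.

Lemma sqn_ge0 x : 0 <= sqn x.
Proof. by rewrite -lee_fin sqnE sqnorm_ge0. Qed.

Lemma l2normE x : l2norm x = Num.sqrt (sqn x). Proof. by []. Qed.

Lemma esumZ (k : R) (f : I -> R) : 0 <= k -> (forall i, 0 <= f i) ->
  \esum_(i in [set: I]) (k * f i)%:E = (k%:E * \esum_(i in [set: I]) (f i)%:E)%E.
Proof.
have le (l : R) (g : I -> R) : 0 <= l -> (forall i, 0 <= g i) ->
    (\esum_(i in [set: I]) (l * g i)%:E <= l%:E * \esum_(i in [set: I]) (g i)%:E)%E.
  move=> l0 g0; rewrite [leLHS]/esum ge_ereal_sup// => _ [A [finA _] <-].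
  under eq_fsbigr do rewrite EFinM.
  rewrite -ge0_mule_fsumr; last by move=> i; rewrite lee_fin.
  by rewrite lee_wpmul2l ?lee_fin// esum_ge//; exists A.
move=> k0 f0; apply/eqP; rewrite eq_le le//=.
have [->|kn0] := eqVneq k 0.
  by rewrite mul0e esum_ge0// => i _; rewrite mul0r.
have -> : \esum_(i in [set: I]) (f i)%:E = \esum_(i in [set: I]) (k^-1 * (k * f i))%:E.
  by apply: eq_esum => i _; rewrite mulKf.
rewrite (le_trans (lee_wpmul2l _ (le k^-1 _ _ _)))// ?lee_fin// ?invr_ge0//.
- by move=> i; rewrite mulr_ge0.
- by rewrite muleA -EFinM mulfV// mul1e.
Qed.

Lemma esum_absqZ (k : R) x : 0 <= k ->
  \esum_(i in [set: I]) (k * absq (x i))%:E = (k * sqn x)%:E.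
Proof. by move=> k0; rewrite esumZ// => [|i]; rewrite ?absq_ge0// EFinM sqnE. Qed.

(** A pointwise domination by finitely many translated copies of a vector is the
   common form of the estimates on convolution operators. *)
Lemma sqn_le (J : Type) (s : seq J) (k : J -> R) (y : J -> H) x :
  (forall j, 0 <= k j) ->
  (forall i, absq (x i) <= \sum_(j <- s) k j * absq (y j i)) ->
  sqn x <= \sum_(j <- s) k j * sqn (y j).
Proof.
move=> k0 xy; rewrite -lee_fin sqnE.
have ay j i : 0 <= k j * absq (y j i) by rewrite mulr_ge0// absq_ge0.
apply: (@le_trans _ _ (\esum_(i in [set: I]) (\sum_(j <- s) k j * absq (y j i))%:E)%E).
  by apply: le_esum => i _; rewrite lee_fin; exact: xy.
elim: s {xy} => [|j s IH].
  by rewrite big_nil esum1// => i _; rewrite big_nil.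
rewrite big_cons EFinD -esum_absqZ//.
under eq_esum do rewrite big_cons EFinD.
by rewrite esumD ?leeD// => i _; rewrite lee_fin ?sumr_ge0.
Qed.

Lemma absq_le_sqn x i : absq (x i) <= sqn x.
Proof.
rewrite -lee_fin sqnE; apply: esum_ge; exists [set i]; last by rewrite fsbig_set1.
by split => //; exact: finite_set1.
Qed.

Lemma sqn_eq0 x : sqn x = 0 -> x = 0.
Proof.
move=> x0; apply: ell2P => i; apply: absq_eq0; apply/eqP.
by rewrite eq_le absq_ge0 andbT -x0 absq_le_sqn.
Qed.

Lemma sqn0 : sqn 0 = 0.
Proof.
by apply: EFin_inj; rewrite sqnE /sqnorm esum1// => i _; rewrite -[_ ^+ 2]/(absq 0) absq0.
Qed.

Lemma sqnZ c x : sqn (c *: x) = absq c * sqn x.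
Proof.
apply: EFin_inj; rewrite sqnE -esum_absqZ ?absq_ge0//.
by apply: eq_esum => i _; rewrite -absqM.
Qed.

Lemma sqn_parallelogram x y : sqn (x + y) + sqn (x - y) = 2 * sqn x + 2 * sqn y.
Proof.
have a0 (z : H) i : (0 <= (absq (z i))%:E)%E by rewrite lee_fin absq_ge0.
have b0 (z : H) i : (0 <= (2 * absq (z i))%:E)%E by rewrite lee_fin mulr_ge0// absq_ge0.
apply: EFin_inj; rewrite !EFinD -!esum_absqZ// !sqnE /sqnorm.
rewrite -[LHS]esumD; [|by move=> i _; exact: a0..].
rewrite -[RHS]esumD; [|by move=> i _; exact: b0..].
by apply: eq_esum => i _; rewrite -!EFinD -absq_parallelogram.
Qed.

Lemma sqnD_le x y : sqn (x + y) <= 2 * sqn x + 2 * sqn y.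
Proof. by rewrite -sqn_parallelogram lerDl sqn_ge0. Qed.

Lemma sqnN x : sqn (- x) = sqn x.
Proof.
rewrite -scaleN1r sqnZ.
by have -> : absq (-1 : R[i]) = 1; [rewrite absqE/=; ring|rewrite mul1r].
Qed.

Lemma sqnB_le x y : sqn (x - y) <= 2 * sqn x + 2 * sqn y.
Proof. by rewrite -(sqnN y); exact: sqnD_le. Qed.

End SquaredNorm.

(** * Bounded operators and norm closures *)

Section OperatorNorm.
Variables (R : realType) (I : choiceType).
Local Notation H := (ell2 R I).
Implicit Types (T S : H -> H) (x y : H).

Lemma opnorm_le T (M : R) : 0 <= M ->
  (forall x, sqn (T x) <= M ^+ 2 * sqn x) -> (opnorm T <= M%:E)%E.
Proof.
move=> M0 TM; rewrite /opnorm ge_ereal_sup// => _ [x /= x1 <-].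
rewrite lee_fin l2normE -(ger0_norm M0) -sqrtr_sqr ler_wsqrtr//.
rewrite (le_trans (TM x))// ler_piMr ?sqr_ge0//.
by move: x1; rewrite l2normE -[leRHS]sqrtr1 ler_psqrt// nnegrE ?sqn_ge0.
Qed.

Lemma sqn_opnorm T (M : R) x : 0 <= M -> (forall c y, T (c *: y) = c *: T y) ->
  (opnorm T <= M%:E)%E -> sqn (T x) <= M ^+ 2 * sqn x.
Proof.
move=> M0 Tz TM; have [/sqn_eq0 ->|x0] := eqVneq (sqn x) 0.
  by rewrite -[X in T X](scale0r (0 : H)) Tz scale0r sqn0 mulr0.
have r0 : 0 < Num.sqrt (sqn x) by rewrite sqrtr_gt0 lt_neqAle eq_sym x0 sqn_ge0.
pose c : R[i] := ((Num.sqrt (sqn x))^-1)%:C%C.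
have ac : absq c = (sqn x)^-1.
  by rewrite absqE/= expr0n addr0 exprVn sqr_sqrtr// sqn_ge0.
have /le_trans/(_ TM) : ((l2norm (T (c *: x)))%:E <= opnorm T)%E.
  by apply: ereal_sup_ubound; exists (c *: x) => //=; rewrite l2normE sqnZ ac mulVf// sqrtr1.
rewrite lee_fin l2normE Tz sqnZ ac -ler_sqr ?nnegrE// ?sqrtr_ge0// sqr_sqrtr ?mulr_ge0 ?invr_ge0 ?sqn_ge0//.
by rewrite mulrC ler_pdivrMr// lt_neqAle eq_sym x0 sqn_ge0.
Qed.

Lemma linear_scale T : linear T -> forall c y, T (c *: y) = c *: T y.
Proof.
move=> Tl c y; rewrite -[c *: y]addr0 Tl.
have -> : T 0 = 0 by have := Tl (-1) 0 0; rewrite !scaleN1r !addNr.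
by rewrite addr0.
Qed.

Lemma linear_add T : linear T -> forall x y, T (x + y) = T x + T y.
Proof. by move=> Tl x y; rewrite -[x]scale1r Tl !scale1r. Qed.

Lemma linear_sub T : linear T -> forall x y, T (x - y) = T x - T y.
Proof. by move=> Tl x y; rewrite addrC -scaleN1r Tl scaleN1r addrC. Qed.

Lemma bounded_operatorP T :
  bounded_operator T <->
  linear T /\ exists2 K : R, 0 < K & forall x, sqn (T x) <= K * sqn x.
Proof.
split=> -[Tl TK]; split=> //; last first.
  case: TK => K K0 TK; apply: (@le_lt_trans _ _ (Num.sqrt K)%:E); last by rewrite ltry.
  by apply: opnorm_le; rewrite ?sqrtr_ge0// => x; rewrite sqr_sqrtr ?(ltW K0)//; exact: TK.
have T0 : (0 <= opnorm T)%E.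
  apply: (@le_trans _ _ (l2norm (T 0))%:E); first by rewrite lee_fin sqrtr_ge0.
  by apply: ereal_sup_ubound; exists 0 => //=; rewrite l2normE sqn0 sqrtr0.
have Tf : opnorm T \is a fin_num by rewrite ge0_fin_numE.
exists ((fine (opnorm T) + 1) ^+ 2); first by rewrite exprn_gt0// ltr_wpDl ?fine_ge0.
move=> x; apply: sqn_opnorm; first by rewrite addr_ge0 ?fine_ge0.
  exact: linear_scale.
by rewrite -[leLHS]fineK// lee_fin lerDl.
Qed.

(** The approximants need not be bounded operators a priori, but homogeneity is
   enough to turn a bound on the unit ball into an estimate at every vector. *)
Lemma norm_closureP (M : set (H -> H)) T :
  (forall S, M S -> linear S) ->
  norm_closure M T -> forall eps : R, 0 < eps ->
  exists2 S, M S & forall x, sqn (T x - S x) <= eps * sqn x.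
Proof.
move=> Ml [[Tl _] TM] eps eps0.
have [|S MS TS] := TM (Num.sqrt eps); first by rewrite sqrtr_gt0.
exists S => // x; rewrite -[leLHS]/(sqn ((T - S)%R x)) -[X in X * _](sqr_sqrtr (ltW eps0)).
apply: sqn_opnorm; rewrite ?sqrtr_ge0//; last exact: ltW.
by move=> c y; rewrite !fctE (linear_scale Tl) (linear_scale (Ml _ MS)) scalerBr.
Qed.

Lemma norm_closure_in (M : set (H -> H)) T : bounded_operator T -> M T -> norm_closure M T.
Proof.
move=> bT MT; split=> // eps eps0; exists T => //.
rewrite subrr; apply: (@le_lt_trans _ _ 0%:E); last by rewrite lte_fin.
by apply: opnorm_le => // x; rewrite expr0n mul0r sqn0.
Qed.

End OperatorNorm.

(** * Weighted translations *)

Section WeightedTranslation.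
Variables (R : realType) (I : choiceType).
Local Notation H := (ell2 R I).
Implicit Types (x : H) (w : I -> R[i]) (f : I -> I).

(** Only meaningful for bounded [w] and bijective [f]; the default value spares
   the operators below from carrying proofs of summability.  The lock keeps
   unification from unfolding these operators. *)
Definition wtransl w f x : H := locked (insubd 0 (fun i => w i * x (f i))).

Lemma sqnorm_reindex x f : bijective f -> sqnorm (x \o f) = (sqn x)%:E.
Proof.
move=> bf; rewrite sqnE /sqnorm [RHS](reindex_esum setT setT f)//.
by rewrite setTT_bijective.
Qed.

Lemma wtranslE (M : R) w f x i : bijective f -> (forall i, absq (w i) <= M) ->
  wtransl w f x i = w i * x (f i).
Proof.
move=> bf wM; rewrite /wtransl -lock insubdK//.
rewrite inE /= /sqnorm; have M0 : 0 <= M := le_trans (absq_ge0 _) (wM i).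
have := @esumZ R I M (fun i => absq (x (f i))) M0 (fun i => absq_ge0 _).
rewrite -[X in (_ * X)%E]/(sqnorm (x \o f)) sqnorm_reindex// => E.
apply: (@le_lt_trans _ _ (M * sqn x)%:E); last by rewrite ltry.
rewrite EFinM -E; apply: le_esum => j _; rewrite lee_fin.
by rewrite -[leLHS]/(absq _) absqM ler_wpM2r ?absq_ge0.
Qed.

Lemma sqn_wtransl w f x : bijective f -> (forall i, absq (w i) = 1) ->
  sqn (wtransl w f x) = sqn x.
Proof.
move=> bf w1; apply: EFin_inj; rewrite sqnE -(sqnorm_reindex x bf).
apply: eq_esum => i _; rewrite (@wtranslE 1)// => [|j]; last by rewrite w1.
by congr EFin; rewrite -![_ ^+ 2]/(absq _) absqM w1 mul1r.
Qed.

End WeightedTranslation.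

Section Cis.
Variable R : realType.
Implicit Types s t : R.

Definition cis t : R[i] := (cos t +i* sin t)%C.

Lemma cisD s t : cis (s + t) = cis s * cis t.
Proof.
rewrite /cis cosD sinD; apply/eqP; rewrite eq_complex/= eqxx.
by apply/eqP; ring.
Qed.

Lemma absq_cis t : absq (cis t) = 1.
Proof. by rewrite absqE/= cos2Dsin2. Qed.

Lemma cis0 : cis 0 = 1.
Proof. by rewrite /cis cos0 sin0. Qed.

Lemma cisDpi t : cis (t + pi) = - cis t.
Proof. by rewrite /cis cosDpi sinDpi. Qed.

End Cis.

(** * Idempotents that commute with a unitary and are moved continuously by its rotations *)

Section DualFlow.
Variables (R : realType) (I : choiceType).
Local Notation H := (ell2 R I).
Variables (f : I -> I) (psi : I -> R).
Hypotheses (f_bij : bijective f) (psif : forall i, psi (f i) = psi i - 1).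
Implicit Types (T p : H -> H) (x y : H) (s t : R).

Definition transl := wtransl (fun=> 1) f : H -> H.
Definition flow s := wtransl (fun i => cis (s * psi i)) id : H -> H.

Lemma translE x i : transl x i = x (f i).
Proof. by rewrite /transl (@wtranslE _ _ 1)// ?mul1r// => j; rewrite absqE/=; lra. Qed.

Lemma flowE s x i : flow s x i = cis (s * psi i) * x i.
Proof. by rewrite /flow (@wtranslE _ _ 1)// => [|j]; [exists id|rewrite absq_cis]. Qed.

Lemma sqn_transl x : sqn (transl x) = sqn x.
Proof. by rewrite /transl sqn_wtransl// => i; rewrite absqE/=; lra. Qed.

Lemma sqn_flow s x : sqn (flow s x) = sqn x.
Proof. by rewrite /flow sqn_wtransl// => [|j]; [exists id|rewrite absq_cis]. Qed.

Lemma transl_linear : linear transl.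
Proof. by move=> c x y; apply: ell2P => i; rewrite [LHS]translE [LHS]ell2L [RHS]ell2L 2!translE. Qed.

Lemma flow_linear s : linear (flow s).
Proof. by move=> c x y; apply: ell2P => i; rewrite [LHS]flowE [RHS]ell2L [in LHS]ell2L 2!flowE mulrDr mulrCA. Qed.

(** The dual action multiplies the unitary [transl] by a character: this is what
   rotates its spectrum. *)
Lemma flow_transl s x : flow s (transl x) = cis s *: transl (flow s x).
Proof.
apply: ell2P => i; rewrite [RHS]ell2Z [LHS]flowE 2!translE flowE mulrA -cisD psif.
by congr (cis _ * _); ring.
Qed.

Definition flow_continuous T := forall eps : R, 0 < eps -> exists2 delta : R, 0 < delta &
  forall s x, `|s| <= delta -> sqn (flow s (T x) - T (flow s x)) <= eps * sqn x.

(** The operators that the dual action moves norm-continuously and that commute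
   with [transl]; this is what remains of the crossed product in the argument. *)
Record tame T : Prop := {
  tame_linear : linear T;
  tame_bounded : exists2 K : R, 0 < K & forall x, sqn (T x) <= K * sqn x;
  tame_transl : forall x, T (transl x) = transl (T x);
  tame_flow : flow_continuous T
}.

Lemma tame_comp T S : tame T -> tame S -> tame (T \o S).
Proof.
move=> [Tl [K K0 TK] Tu Tf] [Sl [L L0 SL] Su Sf]; split.
- by move=> c x y; rewrite /= Sl Tl.
- exists (K * L); first exact: mulr_gt0.
  by move=> x /=; rewrite (le_trans (TK _))// -mulrA ler_wpM2l// ltW.
- by move=> x /=; rewrite Su Tu.
move=> eps eps0.
have [|d d0 Td] := Tf (eps / (4 * L)); first by rewrite divr_gt0// mulr_gt0.
have [|e e0 Se] := Sf (eps / (4 * K)); first by rewrite divr_gt0// mulr_gt0.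
exists (Num.min d e); first by rewrite lt_min d0.
move=> s x; rewrite le_min => /andP[sd se] /=.
rewrite -(subrK (T (flow s (S x))) (flow s (T (S x)))) -addrA -linear_sub//.
rewrite (le_trans (sqnD_le _ _))//.
have h1 := le_trans (Td s (S x) sd) (ler_wpM2l _ (SL x)).
have h2 := le_trans (TK _) (ler_wpM2l (ltW K0) (Se s x se)).
have {}h1 : sqn (flow s (T (S x)) - T (flow s (S x))) <= eps / 4 * sqn x.
  rewrite (le_trans (h1 _))//; first by rewrite divr_ge0 ?mulr_ge0// ltW.
  by rewrite le_eqVlt; apply/orP; left; apply/eqP; field; rewrite gt_eqF.
have {}h2 : sqn (T (flow s (S x) - S (flow s x))) <= eps / 4 * sqn x.
  rewrite (le_trans h2)//.
  by rewrite le_eqVlt; apply/orP; left; apply/eqP; field; rewrite gt_eqF.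
lra.
Qed.

(** Both [transl] and the [flow s] are isometries, so the defect of commutation of
   a limit is controlled by that of its approximants, uniformly in [s]. *)
Lemma tame_norm_closure (M : set (H -> H)) T :
  (forall S, M S -> tame S) -> norm_closure M T -> tame T.
Proof.
move=> Mt MT; have [/bounded_operatorP[Tl [K K0 TK]] _] := MT.
have app := norm_closureP (fun S MS => tame_linear (Mt S MS)) MT.
split=> //; first by exists K.
- move=> x; apply/eqP; rewrite -subr_eq0; apply/eqP/sqn_eq0/eqP.
  rewrite eq_le sqn_ge0 andbT; apply/ler_addgt0Pl => e e0; rewrite addr0.
  have x1 : 0 < sqn x + 1 by rewrite ltr_wpDl ?sqn_ge0.
  have [|S MS TS] := app (e / (4 * (sqn x + 1))); first by rewrite divr_gt0// mulr_gt0.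
  have [_ _ Su _] := Mt S MS.
  have -> : T (transl x) - transl (T x) = (T (transl x) - S (transl x)) - transl (T x - S x).
    by rewrite (linear_sub transl_linear) Su opprB addrA subrK.
  rewrite (le_trans (sqnB_le _ _))// sqn_transl.
  have := TS x; have := TS (transl x); rewrite sqn_transl => h1 h2.
  have h : e / (4 * (sqn x + 1)) * sqn x <= e / 4.
    have -> : e / (4 * (sqn x + 1)) * sqn x = e / 4 * (sqn x / (sqn x + 1)).
      by field; rewrite gt_eqF.
    by rewrite ler_piMr ?divr_ge0 ?(ltW e0)// ler_pdivrMr// mul1r lerDl.
  lra.
- move=> eps eps0.
  have [|S MS TS] := app (eps / 16); first by rewrite divr_gt0.
  have [Sl _ _ Sf] := Mt S MS.
  have [|d d0 Sd] := Sf (eps / 4); first by rewrite divr_gt0.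
  exists d => // s x sd.
  have -> : flow s (T x) - T (flow s x) =
      (flow s (S x) - S (flow s x)) + (flow s (T x - S x) - (T (flow s x) - S (flow s x))).
    have E (a b c g : H) : a - b = (c - g) + ((a - c) - (b - g)).
      by rewrite opprB addrACA [c + _]addrC subrK addKr.
    by rewrite (linear_sub (flow_linear s)) -E.
  rewrite (le_trans (sqnD_le _ _))//.
  have h1 := sqnB_le (flow s (T x - S x)) (T (flow s x) - S (flow s x)).
  have := TS x; have := TS (flow s x); rewrite sqn_flow => h2 h3.
  rewrite sqn_flow in h1.
  have := Sd s x sd; lra.
Qed.

Section Idempotent.
Variable p : H -> H.
Hypotheses (pt : tame p) (pp : p \o p = p).

Definition bounded_below m t :=
  forall x, p x = x -> m * sqn x <= sqn (x - cis t *: transl x).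

(** For [x] in the range of [p], the vector [z = p (flow s x)] is again in that
   range.  It is not much shorter than [x] because [p] almost commutes with
   [flow s], and [(1 - e^(i t) u) z] is the image under [p] and [flow s] of
   [(1 - e^(i (t - s)) u) x]: a lower bound at [z] gives one at [x]. *)
Lemma bounded_below_step : exists2 d : R, 0 < d & exists2 k : R, 0 < k &
  forall m t s, 0 < m -> `|s| <= d -> bounded_below m t -> bounded_below (m * k) (t - s).
Proof.
have [pl [K K0 pK] pu pf] := pt.
have [|d d0 pd] := pf (4^-1); first by lra.
exists d => //; exists ((4 * K)^-1); first by rewrite invr_gt0 mulr_gt0.
move=> m t s m0 sd mt x px.
set y := flow s x; set z := p y.
have yz : sqn (y - z) <= 4^-1 * sqn x by have := pd s x sd; rewrite px.
have xz : 4^-1 * sqn x <= sqn z.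
  have := sqnD_le (y - z) z; rewrite subrK {1}/y sqn_flow.
  move: yz; lra.
have pz : p z = z by rewrite -[RHS]/(p y) -[in RHS]pp.
have zx : z - cis t *: transl z = p (flow s (x - cis (t - s) *: transl x)).
  rewrite (linear_sub (flow_linear s)) (linear_scale (flow_linear s)) flow_transl.
  by rewrite scalerA -cisD subrK (linear_sub pl) (linear_scale pl) pu.
have := mt z pz; rewrite zx => h.
have := pK (flow s (x - cis (t - s) *: transl x)); rewrite sqn_flow => h'.
rewrite mulrAC ler_pdivrMr ?mulr_gt0//.
have := ler_wpM2l (ltW m0) xz; rewrite mulrCA.
move: h h'; lra.
Qed.

Lemma bounded_below_segment (m b : R) : 0 < m -> bounded_below m 0 ->
  exists2 m' : R, 0 < m' & forall t, `|t| <= b -> bounded_below m' t.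
Proof.
move=> m0 pm; have [d d0 [k k0 step]] := bounded_below_step.
have H n : forall t, `|t| <= n%:R * d -> bounded_below (m * k ^+ n) t.
  elim: n => [|n IH] t; first by rewrite mul0r normr_le0 => /eqP ->; rewrite mulr1.
  move=> tn; have n0 : 0 < n.+1%:R :> R by rewrite ltr0n.
  (* [n] of the [n.+1] equal steps from 0 to [t], then one step of length at most [d] *)
  have -> : t = (n%:R / n.+1%:R) * t - (- t / n.+1%:R).
    by rewrite -natr1; field; rewrite natr1 gt_eqF.
  rewrite exprSr mulrA; apply: step; first by rewrite mulr_gt0 ?exprn_gt0.
    by rewrite normrM normrN normfV (ger0_norm (ltW n0)) ler_pdivrMr// mulrC.
  apply: IH; rewrite normrM ger0_norm ?divr_ge0// -mulrA ler_wpM2l//.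
  by rewrite ler_pdivrMl// mulrC [_ * d]mulrC mulrC.
have [n nb] : exists n, b <= n%:R * d.
  exists (Num.truncn (b / d)).+1; rewrite -ler_pdivrMr//.
  exact/ltW/truncnS_gt.
exists (m * k ^+ n); first by rewrite mulr_gt0 ?exprn_gt0.
by move=> t tb; apply: H; exact: le_trans tb nb.
Qed.

(** Factor [1 - c^2 w^2 = (1 - c w) (1 + c w)] with [w] the power [2 ^ k] of
   [transl] and [c] one of the two square roots of [cis t].  By the parallelogram
   law, [1 + c w] doubles the squared norm of [x] for at least one of these roots.
   Repeating this [k] times yields a long vector [y] whose image under
   [1 - cis s *: transl] is no longer than twice [x]. *)
Lemma approximate_eigenvector k : forall t x, 0 <= t <= 2 * pi -> p x = x ->
  exists s y, [/\ 0 <= s <= 2 * pi, p y = y, 2 ^+ k * sqn x <= sqn y &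
    y - cis s *: transl y = x - cis t *: iter (2 ^ k) transl x].
Proof.
have [pl _ pu _] := pt.
elim: k => [|k IH] t x t0 px; first by exists t, x; split; rewrite ?mul1r.
set w := iter (2 ^ k) transl.
have wl : linear w.
  rewrite /w; elim: (2 ^ k)%N => [|n IHn] c a b //=.
  by rewrite IHn transl_linear.
have wn a : sqn (w a) = sqn a.
  by rewrite /w; elim: (2 ^ k)%N => [|n IHn] //=; rewrite sqn_transl.
have pw a : p (w a) = w (p a).
  by rewrite /w; elim: (2 ^ k)%N => [|n IHn] //=; rewrite pu IHn.
have E r : cis r * cis r = cis t -> 2 * sqn x <= sqn (x + cis r *: w x) ->
    0 <= r <= 2 * pi -> exists s y, [/\ 0 <= s <= 2 * pi, p y = y, 2 ^+ k.+1 * sqn x <= sqn y &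
    y - cis s *: transl y = x - cis t *: iter (2 ^ k.+1) transl x].
  move=> rt r2 r0.
  have [|s [y [s0 py y2 yE]]] := IH r (x + cis r *: w x) r0.
    by rewrite linear_add// linear_scale// pw px.
  exists s, y; split=> //.
    by rewrite (le_trans _ y2)// exprSr -mulrA ler_wpM2l ?exprn_ge0.
  rewrite yE expnS mul2n -addnn iterD -!/(w _) (linear_add wl) (linear_scale wl).
  by rewrite scalerDr scalerA rt opprD addrA addrK.
have := sqn_parallelogram x (cis (t / 2) *: w x).
rewrite sqnZ absq_cis mul1r wn => P.
have tt : cis (t / 2) * cis (t / 2) = cis t by rewrite -cisD -splitr.
have pi0 : 0 <= pi :> R := pi_ge0 R.
have /andP[t1 t2] := t0.
have [h|h] := leP (2 * sqn x) (sqn (x + cis (t / 2) *: w x)).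
  by apply: E tt h _; apply/andP; split; lra.
apply: (E (t / 2 + pi)).
- by rewrite cisDpi mulrNN.
- by rewrite cisDpi scaleNr; lra.
- by apply/andP; split; lra.
Qed.

Lemma bounded_below_trivial (m : R) : 0 < m -> bounded_below m 0 -> forall x, p x = 0.
Proof.
move=> m0 /(bounded_below_segment (2 * pi) m0)[{}m {}m0 pm] x.
suff H0 z : p z = z -> z = 0 by apply: H0; rewrite -[RHS]/(p x) -[in RHS]pp.
move: z => {}x px; apply/sqn_eq0/eqP; rewrite eq_le sqn_ge0 andbT leNgt; apply/negP => x0.
(* the image of [y] has squared norm at most [4 * sqn x], whereas [sqn y] is at least [2 ^+ k * sqn x] *)
pose k := (Num.truncn (4 / m)).+1.
have [|s [y [s0 py y2 yE]]] := approximate_eigenvector k (t := 0) _ px.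
  by rewrite lexx/= mulr_ge0 ?pi_ge0.
have := pm s _ y py; rewrite ger0_norm ?(andP s0).1//.
move=> /(_ (andP s0).2); rewrite yE cis0 scale1r => h.
have := sqnB_le x (iter (2 ^ k) transl x).
have -> : sqn (iter (2 ^ k) transl x) = sqn x.
  by elim: (2 ^ k)%N => [|n IHn] //=; rewrite sqn_transl.
move=> h'.
have k4 : 4 / m < 2 ^+ k.
  apply: (lt_le_trans (truncnS_gt _)).
  by rewrite -natrX ler_nat ltnW// ltn_expl.
have {}k4 : 4 * sqn x < m * (2 ^+ k * sqn x).
  by rewrite mulrA ltr_pM2r// mulrC -ltr_pdivrMr.
have := ler_wpM2l (ltW m0) y2; lra.
Qed.

End Idempotent.
End DualFlow.

(** * Central elements act trivially on boundaries *)

Section CentralAction.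
Variables (R : realType) (G : groupType) (X : ptopologicalType) (act : G -> X -> X).

Lemma continuous_borel_measurable (f : X -> R) : continuous f ->
  measurable_fun [set: borel X] (f : borel X -> R).
Proof.
move=> cf; apply: (measurability _ (RGenOpens.measurableE R)) => _ [_ [a [b ->]] <-].
rewrite setTI; apply: sub_sigma_algebra => /=.
by apply: (open_comp (fun x _ => cf x)); exact: interval_open.
Qed.

(** A point is compact: it exhausts its own mass. *)
Lemma regular_dirac (x : X) : @regular R X (\d_(x : borel X)).
Proof.
move=> A mA; apply/eqP; rewrite eq_le; apply/andP; split; last first.
  apply: ge_ereal_sup => _ [K [_ KA] <-]; rewrite !diracE lee_fin ler_nat.
  by case: (boolP (x \in K)) => //= /set_mem/KA/mem_set ->.
have [xA|xA] := boolP ((x : borel X) \in A).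
  apply: ereal_sup_ubound; exists [set x].
    by split; [exact: compact_set1|move=> _ ->; exact: set_mem].
  by rewrite !diracE xA mem_set.
apply: ereal_sup_ubound; exists set0; first by split => //; exact: compact0.
by rewrite !diracE (negbTE xA) in_set0.
Qed.

Lemma integral_pushforward_dirac (x : X) (g : G) (f : X -> R) : continuous f ->
  fine (\int[pushforward (\d_(x : borel X)) (act g : borel X -> borel X)]_(y in
    [set: borel X]) (f y)%:E) = f (act g x).
Proof.
move=> cf.
have -> : pushforward (\d_(x : borel X)) (act g : borel X -> borel X) =
    \d_(act g x : borel X) :> (set (borel X) -> \bar R).
  apply/funext => A; rewrite /pushforward !diracE; congr (_%:R%:E).
rewrite integral_dirac//; last by apply/measurable_EFinP; exact: continuous_borel_measurable.
by rewrite diracT mul1e.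
Qed.

(** Urysohn's lemma in a compact Hausdorff, hence normal, space. *)
Lemma separate_points : compact [set: X] -> hausdorff_space X ->
  forall x y : X, (forall f : X -> R, continuous f -> f x = f y) -> x = y.
Proof.
move=> cX hX x y fxy; apply: contrapT => /eqP xy.
have cl1 (z : X) : closed [set z] by apply: accessible_closed_set1; exact: (hausdorff_accessible hX).
have /(@normal_separatorP R) sep := compact_normal hX cX.
have /(@uniform_separatorP _ R)[f [cf _ f0 f1]] :
    uniform_separator [set x] [set y].
  apply: sep => //; apply/seteqP; split=> // z [-> xy'].
  by move: xy; rewrite -xy' eqxx.
have /eqP := fxy f cf.
have -> : f x = 0 by apply: f0; exists x.
have -> : f y = 1 by apply: f1; exists y.
by rewrite eq_sym oner_eq0.
Qed.

(** Strong proximality, applied to the point masses at [x] and [h x], makes the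
   net [g_i x] and its [h]-translate converge to the same measure: since [h] is
   central, every cluster point of the net is fixed by [h].  The fixed points of
   [h] form a closed invariant set. *)
Lemma central_acts_trivially (h : G) : is_boundary R act ->
  (forall g, (g * h)%g = (h * g)%g) -> forall x, act h x = x.
Proof.
move=> [[cX hX act1 actM actc] mini prox] hC.
have [y hy] : exists y, act h y = y.
  pose x : X := point.
  have [F [FF [rho [_ mu_rho nu_rho]]]] := prox (\d_(x : borel X))
    (\d_(act h x : borel X)) (regular_dirac _) (regular_dirac _).
  have FX : ProperFilter (act^~ x @ F) by exact: fmap_proper_filter.
  have [|y [_ yF]] := cX _ FX; first exact: filterT.
  exists y; apply: separate_points => // f cf.
  have H1 := mu_rho f cf; have H2 := nu_rho f cf.
  set L := fine _ in H1 H2.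
  have E1 : f \o act^~ x @ F --> L.
    by apply: cvg_trans H1; apply: near_eq_cvg; near=> g; rewrite integral_pushforward_dirac.
  have E2 : (f \o act h) \o act^~ x @ F --> L.
    apply: cvg_trans H2; apply: near_eq_cvg; near=> g.
    by rewrite integral_pushforward_dirac//= -!actM hC.
  have lim (k : X -> R) : continuous k -> k \o act^~ x @ F --> L -> k y = L.
    move=> ck kL; apply: (@norm_hausdorff _ R^o) => A B yA LB.
    have := yF (k @^-1` B) (k @^-1` A) (kL _ LB) (ck y _ yA).
    by move=> [z [zB zA]]; exists (k z).
  rewrite (lim f)// -(lim (f \o act h))//.
  by move=> z; apply: continuous_comp; [exact: actc|exact: cf].
move=> x; apply: (@separate_points cX hX) => f cf.
have : closed [set z | f (act h z) - f z = 0].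
  apply: (@closed_comp _ _ (fun z => f (act h z) - f z) [set 0]).
    move=> z _; apply: (@continuousB _ R^o); last exact: cf.
    by apply: continuous_comp; [exact: actc|exact: cf].
  exact: (@accessible_closed_set1 R^o (hausdorff_accessible (@norm_hausdorff _ R^o))).
move=> cl; apply/eqP; rewrite -subr_eq0; apply/eqP; apply: contrapT => xn.
have [|z [zn [g _ gy]]] := mini y _ _ (closed_openC cl); first by exists x.
by apply: zn; rewrite -gy /= -actM -hC actM hy subrr.
Unshelve. all: by end_near.
Qed.

End CentralAction.

(** * The inner product of l^2(I) *)

Section InnerProduct.
Variables (R : realType) (I : choiceType).
Local Notation H := (ell2 R I).
Implicit Types (x y z : H).

#[local] Existing Instance summability.totally_filter.

Lemma cvg_partial_sum_sqn z :
  summability.partial_sum (fun i => (absq (z i))%:C%C : R[i]^o) @ summability.totally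
    --> ((sqn z)%:C%C : R[i]^o).
Proof.
apply/cvgrPdist_lt => e; rewrite ltcE/= => /andP[/eqP e2 e1].
have -> : e = (complex.Re e)%:C%C by rewrite [LHS]complexE e2 mulr0 addr0.
move: e1; set d := complex.Re e => d0.
have /ereal_sup_gt[_ [A [finA _] <-] zA] :
    ((sqn z - d)%:E < ereal_sup [set (\sum_(i \in A) (absq (z i))%:E)%E | A in fsets setT])%E.
  by rewrite -[ereal_sup _]/(sqnorm z) -sqnE lte_fin ltrBlDr ltrDl.
exists (fset_set A) => // B /= AB.
have -> : summability.partial_sum (fun i => (absq (z i))%:C%C : R[i]^o) B =
    (\sum_(i <- B) absq (z i))%:C%C.
  by rewrite /summability.partial_sum big_seq_fsetE/= rmorph_sum.
rewrite -rmorphB normc_def/= expr0n addr0 sqrtr_sqr ltcR.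
have zB : \sum_(i <- B) absq (z i) <= sqn z.
  rewrite -lee_fin sqnE; apply: esum_ge; exists [set` B] => //.
  by rewrite fsbig_finite//= set_fsetK sumEFin.
rewrite ger0_norm ?subr_ge0// ltrBlDl -ltrBlDr -lte_fin (lt_le_trans zA)//.
rewrite fsbig_finite//= -sumEFin; apply: lee_sum_nneg_subfset.
  exact/fsubsetP.
by move=> i _ _; rewrite lee_fin absq_ge0.
Qed.

(** Polarization writes the sum that defines an inner product as a combination of
   four sums of nonnegative reals, which converge. *)
Lemma mulC_polarization (a b : R[i]) : a * b^*%C = 4^-1%:C%C *
  ((absq (a + b))%:C%C - (absq (a - b))%:C%C +
   'i%C * ((absq (a + 'i%C * b))%:C%C - (absq (a - 'i%C * b))%:C%C)).
Proof.
case: a b => [a1 a2] [b1 b2]; rewrite !absqE; apply/eqP; rewrite eq_complex/=.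
by apply/andP; split; apply/eqP; field.
Qed.

Lemma cvg_l2dot_polarization x y :
  summability.partial_sum (fun i => x i * (y i)^*%C : R[i]^o) @ summability.totally
    --> (4^-1%:C%C * ((sqn (x + y))%:C%C - (sqn (x - y))%:C%C +
   'i%C * ((sqn (x + 'i%C *: y))%:C%C - (sqn (x - 'i%C *: y))%:C%C)) : R[i]^o).
Proof.
have -> : summability.partial_sum (fun i => x i * (y i)^*%C : R[i]^o) =
  fun B => 4^-1%:C%C * (
     (summability.partial_sum (fun i => (absq ((x + y) i))%:C%C : R[i]^o) B -
      summability.partial_sum (fun i => (absq ((x - y) i))%:C%C : R[i]^o) B) + 'i%C *
     (summability.partial_sum (fun i => (absq ((x + 'i%C *: y) i))%:C%C : R[i]^o) B -
      summability.partial_sum (fun i => (absq ((x - 'i%C *: y) i))%:C%C : R[i]^o) B)).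
  apply/funext => B; rewrite /summability.partial_sum -!sumrB !mulr_sumr -big_split/= mulr_sumr.
  by apply: eq_bigr => i _; rewrite mulC_polarization.
apply: cvgMr; apply: cvgD; first by apply: cvgB; exact: cvg_partial_sum_sqn.
by apply: cvgMr; apply: cvgB; exact: cvg_partial_sum_sqn.
Qed.

Lemma l2dotE x y : l2dot x y = 4^-1%:C%C * ((sqn (x + y))%:C%C - (sqn (x - y))%:C%C +
   'i%C * ((sqn (x + 'i%C *: y))%:C%C - (sqn (x - 'i%C *: y))%:C%C)).
Proof. exact: (cvg_lim (@norm_hausdorff _ (R[i]^o)) (@cvg_l2dot_polarization x y)). Qed.

Lemma cvg_l2dot x y :
  summability.partial_sum (fun i => x i * (y i)^*%C : R[i]^o) @ summability.totally
    --> (l2dot x y : R[i]^o).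
Proof. by rewrite l2dotE; exact: cvg_l2dot_polarization. Qed.

Lemma l2dot_unique x y (l : R[i]^o) :
  summability.partial_sum (fun i => x i * (y i)^*%C : R[i]^o) @ summability.totally --> l ->
  l2dot x y = l.
Proof. by move=> /(cvg_lim (@norm_hausdorff _ (R[i]^o))). Qed.

Lemma l2dotBl x x' y : l2dot (x - x') y = l2dot x y - l2dot x' y.
Proof.
apply: l2dot_unique.
rewrite (_ : summability.partial_sum _ =
  summability.partial_sum (fun i => x i * (y i)^*%C : R[i]^o) -
  summability.partial_sum (fun i => x' i * (y i)^*%C : R[i]^o)).
  by apply: cvgB; exact: cvg_l2dot.
apply/funext => B; rewrite fctE /summability.partial_sum -[RHS]sumrB.
by apply: eq_bigr => i _; rewrite -[RHS]mulrBl.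
Qed.

Lemma l2dotBr x y y' : l2dot x (y - y') = l2dot x y - l2dot x y'.
Proof.
apply: l2dot_unique.
rewrite (_ : summability.partial_sum _ =
  summability.partial_sum (fun i => x i * (y i)^*%C : R[i]^o) -
  summability.partial_sum (fun i => x i * (y' i)^*%C : R[i]^o)).
  by apply: cvgB; exact: cvg_l2dot.
apply/funext => B; rewrite fctE /summability.partial_sum -[RHS]sumrB.
by apply: eq_bigr => i _; rewrite -[RHS]mulrBr -[in RHS]rmorphB.
Qed.

Lemma transl_adjoint (f f' : I -> I) : cancel f f' -> cancel f' f ->
  is_adjoint (transl f : H -> H) (transl f').
Proof.
move=> ff' f'f x y.
have bf : bijective f by exists f'. have bf' : bijective f' by exists f.
have E c : sqn (transl f x + c *: y) = sqn (x + c *: transl f' y).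
  rewrite -[RHS](sqn_transl bf) (linear_add (transl_linear bf)) (linear_scale (transl_linear bf)).
  congr (sqn (_ + _ *: _)); apply: ell2P => i.
  by rewrite translE// translE// ff'.
have := (E (-1), E 1, E 'i%C, E (- 'i%C)); rewrite !scaleN1r !scale1r !scaleNr => -[[[E1 E2] E3] E4].
by rewrite !l2dotE E1 E2 E3 E4.
Qed.

Lemma difference_adjoint (f f' : I -> I) : cancel f f' -> cancel f' f ->
  is_adjoint (fun x : H => x - transl f x) (fun x => x - transl f' x).
Proof. by move=> ff' f'f x y; rewrite l2dotBl l2dotBr (transl_adjoint ff' f'f). Qed.

End InnerProduct.

(** * Elementary estimates *)

Section SumEstimates.
Variable R : realType.

(** A crude substitute for the Cauchy-Schwarz inequality; only finiteness of the constant matters. *)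
Lemma absq_sum_le (J : Type) (s : seq J) (F : J -> R[i]) :
  absq (\sum_(q <- s) F q) <= 2 ^+ size s * \sum_(q <- s) absq (F q).
Proof.
elim: s => [|q s IH]; first by rewrite !big_nil absq0 mulr0.
rewrite !big_cons /= exprS -mulrA mulrDr.
have /le_trans -> // : absq (F q + \sum_(j <- s) F j) <=
    2 * absq (F q) + 2 * absq (\sum_(j <- s) F j).
  by rewrite -absq_parallelogram lerDl absq_ge0.
rewrite -[leLHS]mulrDr ler_wpM2l// lerD// ler_peMl ?absq_ge0//.
by rewrite exprn_ege1// ler1n.
Qed.

Lemma absq_cisB1_small (J : Type) (s : seq J) (a : J -> R) (eps : R) : 0 < eps ->
  exists2 delta : R, 0 < delta & forall t, `|t| <= delta ->
    \sum_(q <- s) absq (cis (t * a q) - 1) <= eps.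
Proof.
elim: s eps => [|q s IH] eps eps0.
  by exists 1 => // t _; rewrite big_nil ltW.
have [|d d0 ds] := IH (eps / 2); first by rewrite divr_gt0.
have : (fun t : R => cos (t * a q)) @ (0 : R) --> cos (0 * a q).
  apply: continuous_comp; last exact: continuous_cos.
  by apply: (@cvgMl _ R^o); exact: cvg_id.
move=> /cvgrPdist_le /(_ (eps / 4)).
rewrite divr_gt0// => /(_ isT)/nbhs_ballP[e /= e0 eq].
exists (Num.min d (e / 2)); first by rewrite lt_min d0 divr_gt0.
move=> t; rewrite le_min => /andP[td te]; rewrite big_cons.
have := ds t td; have := eq t; rewrite /ball/= sub0r normrN => /(_ _)/wrap[].
  by rewrite (le_lt_trans te)// gtr_pMr// invf_lt1// ltr1n.
rewrite mul0r cos0 => h1.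
have -> : absq (cis (t * a q) - 1) = 2 * (1 - cos (t * a q)).
  by rewrite absqE/= subr0; have := cos2Dsin2 (t * a q); nra.
have := ler_norm (1 - cos (t * a q)); lra.
Qed.

Lemma continuous_absq_bounded (X : ptopologicalType) (k : X -> R[i]^o) :
  compact [set: X] -> continuous k -> exists2 M : R, 0 <= M & forall x, absq (k x) <= M.
Proof.
move=> cX ck.
have nE (z : R[i]) : `|z| = (Normc.normc z)%:C%C by case: z => a b; rewrite normc_def.
have rE (r : R) : `|r%:C%C : R[i]| = `|r|%:C%C.
  by rewrite normc_def/= expr0n addr0 sqrtr_sqr.
pose n (x : X) : R := Normc.normc (k x).
have cn : continuous n.
  move=> x; apply/cvgrPdist_lt => e e0.
  have e0' : 0 < e%:C%C :> R[i] by rewrite ltcR.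
  have /cvgrPdist_lt/(_ _ e0') := ck x; apply: filterS => y.
  rewrite nE ltcR; apply: le_lt_trans; rewrite -lecR -nE.
  have -> : `|n x - n y|%:C%C = `| `|k x| - `|k y| |.
    by rewrite (nE (k x)) (nE (k y)) -rmorphB rE.
  exact: ler_dist_dist.
have /compact_bounded[M [_ nM]] : compact (n @` setT).
  by apply: continuous_compact => //; exact: continuous_subspaceT.
exists ((M + 1) ^+ 2) => [|x]; first exact: sqr_ge0.
have nx : n x <= M + 1.
  by apply: le_trans (nM (M + 1) _ (n x) _); rewrite ?ler_norm ?ltrDl//; exists x.
rewrite -[leLHS]/(n x ^+ 2) ler_sqr// nnegrE ?sqrtr_ge0//; last first.
  by apply: le_trans nx; rewrite /n; case: (k x) => a b; rewrite sqrtr_ge0.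
by rewrite /n; case: (k x) => a b; rewrite sqrtr_ge0.
Qed.

End SumEstimates.

(** * The crossed product *)

(** If the zero operator is the only projection available, an approximate identity
   of projections forces every element [c] to vanish. *)
Lemma opnorm_comp0B_eq0 (R : realType) (I : choiceType) (c : ell2 R I -> ell2 R I) :
  linear c -> opnorm (0 \o c - c) = 0%E -> forall x, c x = 0.
Proof.
move=> cl c0 x; have E y : (0 \o c - c)%R y = - c y by rewrite !fctE /= sub0r.
apply/sqn_eq0/eqP; rewrite eq_le sqn_ge0 andbT -sqnN -E.
rewrite (le_trans (sqn_opnorm x (lexx 0) _ _)) ?c0 ?expr0n ?mul0r// => d y.
by rewrite !E linear_scale// scalerN.
Qed.

Section PointMass.
Variables (R : realType) (I : choiceType).

Definition point_mass (j : I) : ell2 R I := insubd 0 (fun i => (i == j)%:R).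

Lemma point_massE j i : point_mass j i = (i == j)%:R.
Proof.
rewrite /point_mass insubdK//= inE /= /sqnorm.
rewrite [ltLHS](_ : _ = 1%E) ?ltry//.
rewrite -[RHS](@esum_set1 R I j (fun=> 1%E))// [RHS]esum_mkcond.
apply: eq_esum => k _; rewrite -[_ ^+ 2]/(absq _) absqE.
have -> : (k \in [set j]%classic) = (k == j) by apply/idP/eqP => [/set_mem|->]; [|apply/mem_set].
by case: (k == j); rewrite /= expr0n ?expr1n addr0.
Qed.

End PointMass.

Section CrossedProduct.
Variables (R : realType) (G : groupType) (X : ptopologicalType) (act : G -> X -> X).
Local Notation GX := (G * X)%type.
Local Notation H := (ell2 R GX).
Local Notation B := (@reduced_crossed_product R G X act).

Definition lact (k : G) (i : GX) : GX := ((k^-1 * i.1)%g, i.2).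

Lemma lactK k : cancel (lact k) (lact k^-1).
Proof. by case=> g x; rewrite /lact/= invgK mulVKg. Qed.

Lemma lactVK k : cancel (lact k^-1) (lact k).
Proof. by case=> g x; rewrite /lact/= invgK mulKg. Qed.

Lemma lact_bij k : bijective (lact k).
Proof. by exists (lact k^-1); [exact: lactK|exact: lactVK]. Qed.

Hypotheses (cX : compact [set: X]) (act1 : forall x, act 1%g x = x)
  (actM : forall g h x, act (g * h)%g x = act g (act h x)).
Variables (h : G) (phi : G -> R).
Hypotheses (hC : forall g, (g * h)%g = (h * g)%g) (hact : forall x, act h x = x).
Hypotheses (phiM : forall g k, phi (g * k)%g = phi g + phi k) (phih : phi h = 1).

Let phi1 : phi 1%g = 0.
Proof. by have := phiM 1%g 1%g; rewrite mulg1 => /eqP; rewrite -subr_eq subrr eq_sym => /eqP. Qed.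

Let phiV g : phi g^-1%g = - phi g.
Proof. by apply/eqP; rewrite -addr_eq0 addrC -phiM mulgV phi1. Qed.

Let hactV x : act h^-1%g x = x.
Proof. by rewrite -[in LHS](hact x) -actM mulVg act1. Qed.

Let psi (i : GX) := phi i.1.

Let psi_lact i : psi (lact h i) = psi i - 1.
Proof. by rewrite /psi/= phiM phiV phih addrC. Qed.

Local Notation tm := (tame (lact h) psi).

(** The weights [w] cover both an element of the algebraic crossed product, with
   weight 1, and its commutator with [flow t], whose weights are differences of
   phases and small for small [t]. *)
Lemma sqn_convolution_le (s : seq (G * (X -> R[i]^o))) (w : G -> GX -> R[i])
    (C : G -> R) (M : R) (xi zeta : H) :
  0 <= M -> (forall q, q \in s -> forall x, absq (q.2 x) <= M) ->
  (forall k, 0 <= C k) -> (forall k i, absq (w k i) <= C k) ->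
  (forall g x, zeta (g, x) =
    \sum_(q <- s) w q.1 (g, x) * (q.2 (act g x) * xi ((q.1^-1 * g)%g, x))) ->
  sqn zeta <= 2 ^+ size s * M * (\sum_(q <- s) C q.1) * sqn xi.
Proof.
move=> M0 sM C0 wC zE.
apply: (@le_trans _ _ (\sum_(q <- s) (2 ^+ size s * M * C q.1) * sqn (transl (lact q.1) xi))).
  apply: sqn_le => [q|[g x]]; first by rewrite !mulr_ge0// exprn_ge0.
  rewrite zE (le_trans (absq_sum_le _ _))// mulr_sumr big_seq [leRHS]big_seq.
  apply: ler_sum => q qs; rewrite -!mulrA ler_wpM2l ?exprn_ge0// !absqM [leRHS]mulrCA.
  rewrite translE; last exact: lact_bij.
  apply: ler_pM; [exact: absq_ge0|by rewrite -absqM absq_ge0|exact: wC|].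
  by rewrite ler_wpM2r ?absq_ge0// sM.
rewrite mulr_sumr mulr_suml; apply: ler_sum => q _.
by rewrite sqn_transl//; exact: lact_bij.
Qed.

Lemma common_bound (s : seq (G * (X -> R[i]^o))) :
  (forall q, q \in s -> continuous q.2) ->
  exists2 M : R, 0 <= M & forall q, q \in s -> forall x, absq (q.2 x) <= M.
Proof.
elim: s => [|q s IH] sc; first by exists 0.
have [M M0 sM] := IH (fun q' q's => sc q' (mem_behead (s := q :: s) q's)).
have [N N0 qN] := continuous_absq_bounded cX (sc q (mem_head _ _)).
exists (M + N); first exact: addr_ge0.
move=> q'; rewrite inE => /predU1P[->|q's] x.
  by rewrite (le_trans (qN x))// lerDr.
by rewrite (le_trans (sM q' q's x))// lerDl.
Qed.

(** Commutation with [transl] is where the trivial action of the central element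
   [h] enters; the flow only changes the phase of each of the finitely many terms
   of [T]. *)
Lemma algebraic_tame T : algebraic_crossed_product_operators act T -> tm T.
Proof.
move=> [s sc TE]; have [M M0 sM] := common_bound sc.
split.
- move=> c x y; apply: ell2P => -[g z]; rewrite [RHS]ell2L !TE mulr_sumr -big_split.
  by apply: eq_bigr => q _; rewrite ell2L mulrDr mulrCA.
- exists (2 ^+ size s * M * (\sum_(q <- s) 1) + 1).
    by rewrite ltr_wpDl// !mulr_ge0 ?exprn_ge0// sumr_ge0.
  move=> x; rewrite mulrDl mul1r ler_wpDr ?sqn_ge0//.
  apply: (@sqn_convolution_le s (fun _ _ => 1) (fun=> 1)) => // [k i|g z].
    by rewrite absqE/=; lra.
  by rewrite TE; apply: eq_bigr => q _; rewrite mul1r.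
- move=> x; apply: ell2P => -[g z].
  rewrite [RHS]translE; last exact: lact_bij.
  rewrite !TE; apply: eq_bigr => q _; rewrite translE; last exact: lact_bij.
  rewrite /lact/= actM hactV; congr (_ * x (_, _)).
  by rewrite !mulgA (commuteV (hC _) : _ * _ = _)%g.
- move=> eps eps0.
  have K0 : 0 < 2 ^+ size s * M + 1 by rewrite ltr_wpDl// mulr_ge0// exprn_ge0.
  have [|d d0 ds] := @absq_cisB1_small R _ s (fun q => phi q.1) (eps / (2 ^+ size s * M + 1)).
    by rewrite divr_gt0.
  exists d => // t x td.
  apply: (@le_trans _ _ (2 ^+ size s * M * (\sum_(q <- s) absq (cis (t * phi q.1) - 1)) * sqn x)).
    apply: (@sqn_convolution_le s (fun k i => cis (t * phi i.1) - cis (t * phi (k^-1 * i.1)%g))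
      (fun k => absq (cis (t * phi k) - 1))) => // [k|k i|g z]; first exact: absq_ge0.
      rewrite phiM phiV [t * (- _ + _)]mulrDr mulrN.
      have -> : cis (t * phi i.1) = cis (t * phi k) * cis (- (t * phi k) + t * phi i.1).
        by rewrite -cisD addNKr.
      by rewrite -[X in _ - X]mul1r -mulrBl absqM absq_cis mulr1.
    rewrite ell2B flowE !TE mulr_sumr -sumrB; apply: eq_bigr => q _.
    by rewrite flowE /psi/= mulrBl [X in _ - X = _]mulrCA.
  rewrite ler_wpM2r ?sqn_ge0//.
  have := ds t td; rewrite ler_pdivlMr// mulrC; apply: le_trans.
  by rewrite ler_wpM2r ?lerDl// sumr_ge0// => q _; exact: absq_ge0.
Qed.

Lemma reduced_tame T : B T -> tm T.
Proof. by apply: (tame_norm_closure (lact_bij h)) => S; exact: algebraic_tame. Qed.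

Definition difference (k : G) (x : H) : H := x - transl (lact k) x.

Lemma differenceE k x g z : difference k x (g, z) = x (g, z) - x ((k^-1 * g)%g, z).
Proof. by rewrite /difference [LHS]ell2B translE//; exact: lact_bij. Qed.

Lemma difference_algebraic k : algebraic_crossed_product_operators act (difference k).
Proof.
exists [:: (1%g, cst 1); (k, cst (-1))] => [q|xi g z].
  by rewrite !inE => /orP[] /eqP -> /=; exact: cst_continuous.
by rewrite differenceE !big_cons big_nil /= invg1 mul1g mul1r mulN1r addr0.
Qed.

Lemma difference_tame k : tm (difference k).
Proof. exact/algebraic_tame/difference_algebraic. Qed.

Lemma tame_bounded_operator T : tm T -> bounded_operator T.
Proof. by case=> Tl Tb _ _; apply/bounded_operatorP. Qed.

Lemma difference_embedded k : embedded_reduced_group_algebra R G X (difference k).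
Proof.
split; first exact: tame_bounded_operator (difference_tame k).
have bk : bijective (fun g : G => k^-1 * g)%g.
  by exists (fun g => k * g)%g => g; rewrite ?mulVKg ?mulKg.
pose T (eta : ell2 R G) : ell2 R G := eta - transl (fun g => k^-1 * g)%g eta.
have TE eta g : T eta g = eta g - eta (k^-1 * g)%g.
  by rewrite [LHS]ell2B translE.
exists T; last by move=> xi z eta etaE g; rewrite differenceE TE !etaE.
apply: norm_closure_in; last first.
  exists [:: (1%g, 1); (k, -1)] => xi g.
  by rewrite TE !big_cons big_nil /= invg1 mul1g mul1r mulN1r addr0.
apply/bounded_operatorP; split.
  move=> c x y; apply: ell2P => g; rewrite [RHS]ell2L !TE !ell2L; ring.
exists 4 => // x; rewrite (le_trans (sqnB_le _ _))// sqn_transl//; lra.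
Qed.

Let a := difference h^-1%g \o difference h.

Lemma aE x g z : a x (g, z) = 2 * x (g, z) - x ((h^-1 * g)%g, z) - x ((h * g)%g, z).
Proof. by rewrite -[LHS]/(difference h^-1%g (difference h x) (g, z)) 3!differenceE invgK mulKg; ring. Qed.

Let a_tame : tm a.
Proof. exact: tame_comp (difference_tame _) (difference_tame _). Qed.

Let aca_tame c : B c -> tm (a \o c \o a).
Proof. by move=> Bc; exact: tame_comp (tame_comp a_tame (reduced_tame Bc)) a_tame. Qed.

Lemma a_positive : positive_part (embedded_reduced_group_algebra R G X) a.
Proof.
exists (difference h), (difference h^-1%g); split=> //; try exact: difference_embedded.
by apply: difference_adjoint; [exact: lactK|exact: lactVK].
Qed.

Lemma hereditary_tame p : hereditary_subalgebra B a p -> tm p.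
Proof. by apply: (tame_norm_closure (lact_bij h)) => _ [c Bc <-]; exact: aca_tame. Qed.

(** On the range of [p], [x] is close to [a (c (a x))], in which [a x] factors
   through [x - u x]; thus [1 - u] is bounded below there. *)
Lemma hereditary_projection_eq0 p :
  hereditary_subalgebra B a p -> is_projection p -> p = 0.
Proof.
move=> ap [_ pp _]; have pt := hereditary_tame ap.
have [_ [c Bc <-] pc] : exists2 S, [set a \o c \o a | c in B] S &
    forall x, sqn (p x - S x) <= 4^-1 * sqn x.
  apply: norm_closureP ap _ _ => // _ [c Bc <-].
  exact: tame_linear (aca_tame Bc).
have [_ [K K0 cK] _ _] : tm ((a \o c) \o difference h^-1%g).
  exact: tame_comp (tame_comp a_tame (reduced_tame Bc)) (difference_tame _).
have m0 : 0 < (4 * K)^-1 by rewrite invr_gt0 mulr_gt0.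
apply/funext => x; apply: (bounded_below_trivial (lact_bij h) psi_lact pt pp m0) => {}x px.
rewrite cis0 scale1r -[x - _]/(difference h x) mulrC ler_pdivrMr ?mulr_gt0//.
have := pc x; rewrite px => h1.
have := sqnD_le (x - a (c (a x))) (a (c (a x))); rewrite subrK => h2.
have := cK (difference h x); rewrite -[X in sqn X]/(a (c (a x))).
move: h1 h2; rewrite /=; lra.
Qed.

(** The coefficient of [(2 - u - u^-1)^2] at the neutral element is 6, as neither
   [h] nor [h^2] is trivial. *)
Lemma a_square_neq0 (z : X) : a (a (point_mass R (1%g, z))) <> 0.
Proof.
have h1 : h != 1%g by apply/eqP => e; move: phih; rewrite e phi1 => /esym/eqP; rewrite oner_eq0.
have h2 : (h * h)%g != 1%g.
  by apply/eqP => e; have := phiM h h; rewrite e phi1 phih => /eqP; rewrite eq_sym -mulr2n pnatr_eq0.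
have E g : point_mass R (1%g, z) (g, z) = (g == 1%g)%:R by rewrite point_massE xpair_eqE eqxx andbT.
move=> /(congr1 (fun y : H => y (1%g, z))); rewrite -[RHS]/(0 : R[i]) !aE !mulg1 !E.
rewrite mulVg mulgV !invg_eq1 -invgM invg_eq1 (negbTE h1) (negbTE h2) eqxx /=.
move=> /(congr1 (@complex.Re R)) /=; lra.
Qed.

Lemma not_SP : ~ SP_inclusion (embedded_reduced_group_algebra R G X) B.
Proof.
move=> SP; have [|p [ap pp]] := SP a a_positive.
  apply/eqP => a0; apply: (@a_square_neq0 point).
  by rewrite a0.
by rewrite (hereditary_projection_eq0 ap pp) eqxx.
Qed.

(** The element that cannot be approximated is [a^2]. *)
Lemma not_RR0 : ~ real_rank_zero_inclusion (embedded_reduced_group_algebra R G X) B.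
Proof.
move=> RR0; have [|F [FF Fp Fc]] := RR0 a a_positive.
  apply/eqP => a0; apply: (@a_square_neq0 point).
  by rewrite a0.
have Bid : B id.
  apply: norm_closure_in.
    by apply/bounded_operatorP; split => //; exists 1 => // x; rewrite mul1r.
  exists [:: (1%g, cst 1)] => [q|xi g z]; first by rewrite inE => /eqP -> /=; exact: cst_continuous.
  by rewrite big_seq1 /= invg1 mul1g mul1r.
have aa : hereditary_subalgebra B a (a \o id \o a).
  apply: norm_closure_in; last by exists id.
  exact: tame_bounded_operator (aca_tame Bid).
have [Fc1 _] := Fc _ aa.
have F0 : opnorm (0 \o (a \o id \o a) - (a \o id \o a)) = 0%E.
  apply: cvg_unique Fc1; first exact: ereal_hausdorff.
  apply: cvg_near_cst; apply: filterS Fp => e [ae pe].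
  by rewrite (hereditary_projection_eq0 ae pe).
apply: (@a_square_neq0 point).
exact: opnorm_comp0B_eq0 (tame_linear (aca_tame Bid)) F0 (point_mass R (1%g, point)).
Qed.

End CrossedProduct.

(** * Real characters of torsion-free abelian groups *)

Section RealCharacter.
Variables (R : realType) (H : groupType).
Hypotheses (mulC : forall x y : H, (x * y)%g = (y * x)%g) (H_tf : torsion_free H).
Variable h : H.
Hypothesis h1 : h <> 1%g.
Implicit Types (A : set (H * R)) (x y d : H) (r s v : R).

(** Graphs of homomorphisms from a subgroup of [H] to the reals that send [h] to
   [1]; single-valuedness is a condition at the neutral element only. *)
Definition partial_character A :=
  [/\ A (h, 1), forall x y r s, A (x, r) -> A (y, s) -> A ((x / y)%g, r - s)
    & forall r, A (1%g, r) -> r = 0].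

Lemma divMM (a b c d : H) : ((a * b) / (c * d) = (a / c) * (b / d))%g.
Proof. by rewrite invgM [(d^-1 * _)%g]mulC -!mulgA; congr (_ * _)%g; rewrite !mulgA [(b * _)%g]mulC. Qed.

Section Extension.
Variable A : set (H * R).
Hypothesis Ac : partial_character A.

Let A1 : A (1%g, 0).
Proof. by have [Ah Ad _] := Ac; rewrite -(mulgV h) -(subrr (1 : R)); exact: Ad. Qed.

Let AV x r : A (x, r) -> A (x^-1%g, - r).
Proof. by have [_ Ad _] := Ac; rewrite -div1g -sub0r; exact: Ad. Qed.

Let AM x y r s : A (x, r) -> A (y, s) -> A ((x * y)%g, r + s).
Proof. by have [_ Ad _] := Ac; move=> xr /AV ys; rewrite -[y]invgK -[s]opprK; exact: Ad. Qed.

Let AX x r n : A (x, r) -> A ((x ^+ n)%g, n%:R * r).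
Proof.
move=> xr; elim: n => [|n IH]; first by rewrite mul0r.
by rewrite expgS -natr1 mulrDl mul1r addrC; exact: AM.
Qed.

Lemma partial_character_unique x r s : A (x, r) -> A (x, s) -> r = s.
Proof.
have [_ Ad A0] := Ac; move=> xr xs; apply/eqP; rewrite -subr_eq0; apply/eqP/A0.
by rewrite -(mulgV x); exact: Ad.
Qed.

Definition adjoin x v : set (H * R) := [set i | exists d r (m n : nat),
  [/\ A (d, r), i.1 = (d * (x ^+ m / x ^+ n))%g & i.2 = r + (m%:R - n%:R) * v]].

(** Divisibility of the reals: [v] must be the value at [x ^+ k] divided by [k]
   when a positive power of [x] is in the domain, and is free otherwise. *)
Lemma adjoin_functional x : exists v, forall r, adjoin x v (1%g, r) -> r = 0.
Proof.
have dE d m n : (1 = d * (x ^+ m / x ^+ n) -> d = x ^+ n / x ^+ m)%g.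
  by move=> e; rewrite -(invgF (x ^+ m)%g); apply: (@mulIg _ (x ^+ m / x ^+ n)%g); rewrite -e mulVg.
have [[k [r0 [k0 xk]]]|nk] := pselect (exists k r0, (0 < k)%N /\ A ((x ^+ k)%g, r0)).
  exists (r0 / k%:R) => _ [d [r [m [n [dr /= /dE dx ->]]]]].
  have kn0 : k%:R != 0 :> R by rewrite pnatr_eq0 -lt0n.
  have dk : A ((d ^+ k)%g, n%:R * r0 - m%:R * r0).
    have [_ Ad _] := Ac.
    have -> : (d ^+ k = x ^+ k ^+ n / x ^+ k ^+ m)%g.
      by rewrite dx expgnFl ?(expgnAC x k)//; exact: mulC.
    by apply: Ad; exact: AX.
  have := partial_character_unique dk (AX k dr) => e.
  apply: (mulfI kn0); rewrite mulr0 mulrDr -e; field; exact: kn0.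
exists 0 => _ [d [r [m [n [dr /= /dE dx ->]]]]]; rewrite mulr0 addr0.
have [nm|mn|nm] := ltngtP n m.
- case: nk; exists (m - n)%N, (- r); rewrite subn_gt0; split=> //.
  by rewrite expgnFr ?(ltnW nm)// -invgF -dx; exact: AV.
- by case: nk; exists (n - m)%N, r; rewrite subn_gt0 expgnFr ?(ltnW mn)// -dx.
- by have [_ _ A0] := Ac; apply: A0; rewrite dx nm mulgV in dr.
Qed.

Lemma partial_character_extension x : (forall r, ~ A (x, r)) ->
  exists2 A', A `<` A' & partial_character A'.
Proof.
move=> xA; have [v vA] := adjoin_functional x; exists (adjoin x v).
  split.
    move=> [d r] dr; exists d, r, 0%N, 0%N.
    by rewrite /= mulgV mulg1 subrr mul0r addr0.
  move=> sub; apply: (xA v); apply: sub.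
  by exists 1%g, 0, 1%N, 0%N; rewrite /= expg0 divg1 mul1g expg1 subr0 mul1r add0r.
split=> //.
- have [Ah _ _] := Ac; exists h, 1, 0%N, 0%N.
  by rewrite /= mulgV mulg1 subrr mul0r addr0.
move=> y z r s [d [p [m [n [dp /= -> ->]]]]] [d' [p' [m' [n' [dp' /= -> ->]]]]].
have [_ Ad _] := Ac; exists (d / d')%g, (p - p'), (m + n')%N, (n + m')%N; split=> /=.
- exact: Ad.
- rewrite !expgnDr divMM [(x ^+ n * _)%g]mulC !divMM invgK.
  by rewrite [(_^-1 * _)%g in LHS]mulC.
- by rewrite !natrD; ring.
Qed.

End Extension.

Lemma base_partial_character : partial_character
  [set i | exists m n : nat, i = ((h ^+ m / h ^+ n)%g, m%:R - n%:R)].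
Proof.
split.
- by exists 1%N, 0%N; rewrite expg0 divg1 expg1 subr0.
- move=> x y r s [m [n [-> ->]]] [m' [n' [-> ->]]]; exists (m + n')%N, (n + m')%N.
  congr (_, _); last by rewrite !natrD; ring.
  by rewrite !expgnDr [(h ^+ n * _)%g]mulC !divMM invgK [(_^-1 * _)%g in LHS]mulC.
- move=> r [m [n [/esym/divg1_eq e ->]]]; apply/eqP; rewrite subr_eq0; apply/eqP; congr (_%:R).
  have le (p q : nat) : (p < q)%N -> (h ^+ p)%g = (h ^+ q)%g -> False.
    move=> pq epq; apply: h1; have qp : (0 < q - p)%N by rewrite subn_gt0.
    apply: H_tf qp _.
    by rewrite expgnFr ?(ltnW pq)// epq mulgV.
  by have [mn|nm|//] := ltngtP m n; [case: (le _ _ mn e)|case: (le _ _ nm (esym e))].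
Qed.

Lemma exists_real_character :
  exists phi : H -> R, (forall x y, phi (x * y)%g = phi x + phi y) /\ phi h = 1.
Proof.
pose P := [set A | A = set0 \/ partial_character A].
have [|A [PA Amax]] := @Zorn_bigcup (H * R)%type P.
  move=> F FP Ftot; have [[X0 [FX0 X00]]|nX] := pselect (exists X, F X /\ X !=set0); last first.
    left; apply/seteqP; split=> // i [X FX Xi]; apply: nX; exists X; split=> //.
    by exists i.
  right; have Fc X i : F X -> X i -> partial_character X.
    by move=> FX Xi; have [X_0|//] := FP _ FX; rewrite X_0 in Xi.
  have [i0 X0i0] := X00; have [X0h _ _] := Fc _ _ FX0 X0i0.
  split; first by exists X0.
    move=> x y r s [X FX xr] [Y FY ys].
    have [XY|YX] := Ftot _ _ FX FY.
      by exists Y => //; have [_ Yd _] := Fc _ _ FY ys; apply: Yd => //; exact: XY.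
    by exists X => //; have [_ Xd _] := Fc _ _ FX xr; apply: Xd => //; exact: YX.
  by move=> r [X FX xr]; have [_ _ X0'] := Fc _ _ FX xr; exact: X0'.
(* the empty set is admitted for the sake of empty chains only *)
have {PA}Ac : partial_character A.
  case: PA => // A0; exfalso; apply: (Amax _ _ (or_intror base_partial_character)).
  rewrite A0; split => // sub; have [bh _ _] := base_partial_character.
  exact: sub bh.
have dom x : exists r, A (x, r).
  apply: contrapT => nx.
  have [|A' AA' A'c] := partial_character_extension Ac (x := x).
    by move=> r xr; apply: nx; exists r.
  by apply: (Amax _ AA'); right.
exists (fun x => sval (cid (dom x))); have [Ah Ad _] := Ac; split.
  move=> x y; apply: (partial_character_unique Ac (svalP (cid (dom (x * y)%g)))).
  have yV := Ad _ _ _ _ (Ad _ _ _ _ Ah Ah) (svalP (cid (dom y))).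
  have := Ad _ _ _ _ (svalP (cid (dom x))) yV.
  by rewrite mulgV subrr div1g invgK sub0r opprK.
exact: (partial_character_unique Ac (svalP (cid (dom h)))).
Qed.

End RealCharacter.

(** * The non-amenable group GL_2(Q) *)

Section Mean.
Variables (R : realType) (G : groupType) (m : set G -> R).
Hypotheses (m0 : forall A, 0 <= m A) (m1 : m setT = 1)
  (mU : forall A B, A `&` B = set0 -> m (A `|` B) = m A + m B)
  (mg : forall k A, m [set (k * x)%g | x in A] = m A).
Implicit Types A B : set G.

Lemma mean_le A B : A `<=` B -> m A <= m B.
Proof.
move=> AB; rewrite -(setDUK AB) mU ?lerDl//.
by rewrite setDE setICA setICr setI0.
Qed.

Lemma meanU_le A B : m (A `|` B) <= m A + m B.
Proof.
rewrite -(setDUK (@subsetUl _ A B)) mU; last by rewrite setDE setICA setICr setI0.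
by rewrite lerD2l mean_le// => x [[]].
Qed.

(** The translates of [A] by the powers of [k] are pairwise disjoint and all have
   the same mean, so that the mean of [A] is at most [1 / n] for every [n]. *)
Lemma mean_wandering A (k : G) :
  (forall n x, A x -> ~ A (k ^+ n.+1 * x)%g) -> m A = 0.
Proof.
move=> kA; pose U n := [set y | exists2 i : nat, (i < n)%N & A (k ^- i * y)%g].
have mU_ n : m (U n) = n%:R * m A.
  elim: n => [|n IH].
    rewrite mul0r; apply/eqP; rewrite -[m _]addr0 -(subrr (m (U 0%N))) addrA -mU.
      by rewrite setUid subrr.
    by apply/seteqP; split=> // y [] [].
  have -> : U n.+1 = U n `|` [set (k ^+ n * x)%g | x in A].
    apply/seteqP; split=> y.
      move=> [j]; rewrite ltnS leq_eqVlt => /orP[/eqP-> yA|jN yA]; last by left; exists j.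
      by right; exists (k ^- n * y)%g => //; rewrite mulVKg.
    by move=> [[j jN yA]|[x xA <-]]; [exists j => //; exact: ltnW|exists n => //; rewrite mulKg].
  rewrite mU ?IH ?mg -?natr1 ?mulrDl ?mul1r//.
  apply/seteqP; split=> // y [[j jN yA] [x xA xy]].
  have := kA (n - j).-1 x xA; rewrite prednK ?subn_gt0// => nA; apply: nA.
  move: yA; rewrite -xy -(subnKC (ltnW jN)) addKn expgnDr -[(_ * _ * x)%g]mulgA mulKg.
  by [].
apply/eqP; rewrite eq_le m0 andbT leNgt; apply/negP => A0.
have : m (U (Num.truncn (m A)^-1).+1) <= 1 by rewrite -m1 mean_le.
by rewrite mU_ leNgt -ltr_pdivrMr// div1r truncnS_gt.
Qed.

End Mean.

Definition mx2 (a b c d : rat) : 'M[rat]_2 :=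
  \matrix_(i, j) (if i == 0 then if j == 0 then a else b else if j == 0 then c else d).

Lemma det_mx22 (A : 'M[rat]_2) : \det A = A 0 0 * A 1 1 - A 0 1 * A 1 0.
Proof.
rewrite (expand_det_row _ 0) big_ord_recl big_ord1 /cofactor !det_mx11 !mxE /=.
have -> : lift 0 0 = 1 :> 'I_2 by apply/val_inj.
have -> : lift 1 0 = 0 :> 'I_2 by apply/val_inj.
ring.
Qed.

Record gl2q := GL2Q {gl2q_val :> 'M[rat]_2; gl2qP : gl2q_val \in unitmx}.

HB.instance Definition _ := [isSub for gl2q_val].
HB.instance Definition _ := [Countable of gl2q by <:].

Section GL2Q.
Implicit Types g k : gl2q.

Definition gl2q_one := GL2Q (unitmx1 rat 2).
Definition gl2q_mul g k : gl2q.
Proof. by exists (g *m k); rewrite unitmx_mul !gl2qP. Defined.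
Definition gl2q_inv g : gl2q.
Proof. by exists (invmx g); rewrite unitmx_inv gl2qP. Defined.

Lemma gl2q_mulA : associative gl2q_mul.
Proof. by move=> g k l; apply: val_inj; exact: mulmxA. Qed.
Lemma gl2q_mul1 : left_id gl2q_one gl2q_mul.
Proof. by move=> g; apply: val_inj; exact: mul1mx. Qed.
Lemma gl2q_mulr1 : right_id gl2q_one gl2q_mul.
Proof. by move=> g; apply: val_inj; exact: mulmx1. Qed.
Lemma gl2q_mulV : left_inverse gl2q_one gl2q_inv gl2q_mul.
Proof. by move=> g; apply: val_inj; rewrite /= mulVmx ?gl2qP. Qed.
Lemma gl2q_mulrV : right_inverse gl2q_one gl2q_inv gl2q_mul.
Proof. by move=> g; apply: val_inj; rewrite /= mulmxV ?gl2qP. Qed.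

HB.instance Definition _ := isGroup.Build gl2q
  gl2q_mulA gl2q_mul1 gl2q_mulr1 gl2q_mulV gl2q_mulrV.

Definition fst_col g : rat * rat := (gl2q_val g 0 0, gl2q_val g 1 0).

Lemma fst_col_neq0 g : fst_col g != (0, 0).
Proof.
apply/eqP => -[g0 g1]; have := gl2qP g; rewrite unitmxE unitfE det_mx22 g0 g1.
by rewrite mul0r mulr0 subrr eqxx.
Qed.

Lemma mx2_unit (a b c d : rat) : a * d - b * c != 0 -> mx2 a b c d \in unitmx.
Proof. by rewrite unitmxE unitfE det_mx22 !mxE. Qed.

Lemma fst_col_mul (a b c d : rat) (u : mx2 a b c d \in unitmx) g :
  fst_col (GL2Q u * g)%g =
  (a * (fst_col g).1 + b * (fst_col g).2, c * (fst_col g).1 + d * (fst_col g).2).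
Proof.
have l1 : lift 0 0 = 1 :> 'I_2 by apply/val_inj.
by congr (_, _); rewrite /= mxE big_ord_recl big_ord1 l1 !mxE.
Qed.

Lemma shear_norm (n : nat) (x y : rat) : `|x| < `|y| -> `|y| < `|x + 2 * n.+1%:R * y|.
Proof.
move=> xy; have : `|2 * n.+1%:R * y| <= `|x + 2 * n.+1%:R * y| + `|x|.
  by rewrite -[X in `|X| <= _](addKr x) addrC; exact: ler_normB.
rewrite normrM ger0_norm ?mulr_ge0// => h.
have : 2 * `|y| <= 2 * n.+1%:R * `|y| by rewrite ler_wpM2r// ler_peMr// ler1n.
lra.
Qed.

(** The first column of an invertible matrix is a nonzero vector of the plane, on
   which the two elementary matrices below play ping-pong between the cones
   [|y| < |x|] and [|x| < |y|]: both cones are null for an invariant mean, and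
   the diagonals are moved into them. *)
Lemma gl2q_not_amenable (R : realType) : ~ amenable R [set: gl2q].
Proof.
move=> [m [m0_ m1 mU_ mg_]].
have m0 A : 0 <= m A by exact: m0_.
have mU A B : A `&` B = set0 -> m (A `|` B) = m A + m B by exact: mU_.
have mg k A : m [set (k * x)%g | x in A] = m A by exact: mg_.
have ua : mx2 1 2 0 1 \in unitmx by exact: mx2_unit.
have ub : mx2 1 0 2 1 \in unitmx by exact: mx2_unit.
pose a := GL2Q ua; pose b := GL2Q ub.
have aE g : fst_col (a * g)%g = ((fst_col g).1 + 2 * (fst_col g).2, (fst_col g).2).
  by rewrite fst_col_mul !mul1r mul0r add0r.
have bE g : fst_col (b * g)%g = ((fst_col g).1, 2 * (fst_col g).1 + (fst_col g).2).
  by rewrite fst_col_mul !mul1r mul0r addr0.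
have aX n g : fst_col (a ^+ n * g)%g = ((fst_col g).1 + 2 * n%:R * (fst_col g).2, (fst_col g).2).
  elim: n => [|n IH]; first by rewrite mul1g mulr0 mul0r addr0; case: (fst_col g).
  by rewrite expgS -mulgA aE IH /= -natr1; congr (_, _); ring.
have bX n g : fst_col (b ^+ n * g)%g = ((fst_col g).1, (fst_col g).2 + 2 * n%:R * (fst_col g).1).
  elim: n => [|n IH]; first by rewrite mul1g mulr0 mul0r addr0; case: (fst_col g).
  by rewrite expgS -mulgA bE IH /= -natr1; congr (_, _); ring.
pose C1 := [set g | `|(fst_col g).2| < `|(fst_col g).1| ].
pose C2 := [set g | `|(fst_col g).1| < `|(fst_col g).2| ].
pose D1 := [set g | (fst_col g).1 = (fst_col g).2].
pose D2 := [set g | (fst_col g).1 = - (fst_col g).2].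
have C10 : m C1 = 0.
  apply: (mean_wandering m0 m1 mU mg (k := b)) => n g gC.
  rewrite -[C1 _]/(is_true (`|(fst_col (b ^+ n.+1 * g)%g).2| < `|(fst_col (b ^+ n.+1 * g)%g).1|)).
  by rewrite bX ltNge ltW// shear_norm.
have C20 : m C2 = 0.
  apply: (mean_wandering m0 m1 mU mg (k := a)) => n g gC.
  rewrite -[C2 _]/(is_true (`|(fst_col (a ^+ n.+1 * g)%g).1| < `|(fst_col (a ^+ n.+1 * g)%g).2|)).
  by rewrite aX ltNge ltW// shear_norm.
have le0 (A B : set gl2q) : A `<=` B -> m B = 0 -> m A = 0.
  move=> AB B0; apply/eqP; rewrite eq_le m0 andbT -B0.
  exact: mean_le m0 mU _ _ AB.
(* translation by [a] maps [(y, y)] to [(3 y, y)], and [(- y, y)] to [(y, y)] *)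
have D10 : m D1 = 0.
  rewrite -(mg a); apply: le0 C10 => _ [g gD <-]; rewrite -[C1 _]/(is_true (`|(fst_col (a * g)%g).2| < `|(fst_col (a * g)%g).1|)) aE gD /=.
  have -> : (fst_col g).2 + 2 * (fst_col g).2 = 3 * (fst_col g).2 by ring.
  rewrite normrM ger0_norm// ltr_pMl// normr_gt0; apply/eqP => g0.
  have gE : gl2q_val g 0 0 = gl2q_val g 1 0 := gD.
  by have := fst_col_neq0 g; rewrite /fst_col gE g0 eqxx.
have D20 : m D2 = 0.
  rewrite -(mg a); apply: le0 D10 => _ [g gD <-]; rewrite -[D1 _]/((fst_col (a * g)%g).1 = (fst_col (a * g)%g).2) aE gD /=; ring.
have : m [set: gl2q] <= m (C1 `|` C2 `|` D1 `|` D2).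
  apply: mean_le => // g _; case: (ltgtP `|(fst_col g).1| `|(fst_col g).2|) => h.
  - by left; left; right.
  - by left; left; left.
  - move/eqP: h; rewrite eqr_norm2 => /orP[] /eqP h; [by left; right|by right].
have U A B := meanU_le m0 mU A B.
rewrite m1; have := U (C1 `|` C2 `|` D1) D2; have := U (C1 `|` C2) D1; have := U C1 C2.
rewrite C10 C20 D10 D20; lra.
Qed.

(** Normalized so that the scalar matrix 2, of determinant 4, is sent to 1. *)
Definition gl2q_log_det (R : realType) g : R := ln `|ratr (\det (gl2q_val g))| / ln 4.

Lemma gl2q_log_detM (R : realType) g k :
  gl2q_log_det R (g * k)%g = gl2q_log_det R g + gl2q_log_det R k.
Proof.
have det0 l : 0 < `|ratr (\det (gl2q_val l))| :> R.
  by rewrite normr_gt0 fmorph_eq0; have := gl2qP l; rewrite unitmxE unitfE.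
by rewrite /gl2q_log_det -mulrDl -lnM ?posrE// -normrM -rmorphM -det_mulmx.
Qed.

Definition gl2q_double : gl2q.
Proof. by exists 2%:M; rewrite unitmxE det_scalar. Defined.

Lemma gl2q_doubleC g : (g * gl2q_double)%g = (gl2q_double * g)%g.
Proof. by apply: val_inj; rewrite /= scalar_mxC. Qed.

Lemma gl2q_log_det_double (R : realType) : gl2q_log_det R gl2q_double = 1.
Proof.
rewrite /gl2q_log_det /= det_scalar -natrX ratr_nat ger0_norm// mulfV//.
by rewrite gt_eqF// ln_gt0// ltr1n.
Qed.

End GL2Q.

(** * The theorem *)

Lemma central_character_obstruction (R : realType) (G : groupType) (X : ptopologicalType)
    (act : G -> X -> X) (h : G) (phi : G -> R) :
  is_boundary R act -> (forall g, (g * h)%g = (h * g)%g) ->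
  (forall g k, phi (g * k)%g = phi g + phi k) -> phi h = 1 ->
  ~ SP_inclusion (embedded_reduced_group_algebra R G X) (reduced_crossed_product R act) /\
  ~ real_rank_zero_inclusion (embedded_reduced_group_algebra R G X)
                             (reduced_crossed_product R act).
Proof.
move=> bd hC phiM phih; have hact := central_acts_trivially bd hC.
have [[cX _ act1 actM _] _ _] := bd.
split; first exact: (not_SP cX act1 actM hC hact phiM phih).
exact: (not_RR0 cX act1 actM hC hact phiM phih).
Qed.

Theorem theoremC (R : realType) :
  (forall N H : groupType,
     is_amenable_radical R [set 1%g : N] ->
     (forall x y : H, (x * y)%g = (y * x)%g) ->
     torsion_free H ->
     (exists h : H, h <> 1%g) ->
     forall (X : ptopologicalType) (act : (N * H)%type -> X -> X),
       is_furstenberg_boundary R act ->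
       ~ SP_inclusion (embedded_reduced_group_algebra R (N * H)%type X)
                      (reduced_crossed_product R act)) /\
  (exists G : groupType,
     [/\ countable [set: G],
         ~ amenable R [set: G] &
         forall (X : ptopologicalType) (act : G -> X -> X),
           is_furstenberg_boundary R act ->
           ~ SP_inclusion (embedded_reduced_group_algebra R G X)
                          (reduced_crossed_product R act) /\
           ~ real_rank_zero_inclusion (embedded_reduced_group_algebra R G X)
                                      (reduced_crossed_product R act)]).
Proof.
split=> [N H _ mulC Htf [h h1] X act [bd _]|].
  have [phi [phiM phih]] := exists_real_character R mulC Htf h1.
  have hC (g : (N * H)%type) : (g * (1, h) = (1, h) * g)%g.
    by case: g => n k; congr (_, _); rewrite /= ?mulg1 ?mul1g// mulC.
  by have [] := central_character_obstruction bd hC (fun g k => phiM g.2 k.2) phih.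
exists gl2q; split; [exact: countableP|exact: gl2q_not_amenable|].
move=> X act [bd _].
exact: (central_character_obstruction bd gl2q_doubleC (@gl2q_log_detM R) (@gl2q_log_det_double R)).
Qed.
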